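(* Let $(G,T)$ be a comb-bipartite graft with spine set $A$ and tooth set $B$, and let $C_0\in\mathcal{G}(G,T)$. Let $\mathcal{S}$ be the family of equivalence classes of $\sim_{(G,T)}$ contained in $V(C_0)\cap B$ (these form a partition of $V(C_0)\cap B$). Then there exists a unique partition $\{\mathcal{U}(S): S\in\mathcal{S}\}$ of $\mathcal{U}(C_0)$, some of whose members may be empty, satisfying: (i) if $D\in\mathcal{U}(C_0)$ satisfies $N_G(D)\cap V(C_0)\neq\emptyset$ and $S\in\mathcal{S}$ is the class with $N_G(D)\cap V(C_0)\subseteq S$, then $D\in\mathcal{U}(S)$; (ii) if $D\in\mathcal{U}(C_0)$ satisfies $E_G[V(D),V(D')]\neq\emptyset$ for some $D'\in\mathcal{U}(S)$, then $D\in\mathcal{U}(S)$.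
   Context: A graft $(G,T)$: $G$ a graph (loops and parallel edges allowed), $T\subseteq V(G)$ with each connected component containing an even number of vertices of $T$. A join is $F\subseteq E(G)$ such that each vertex $v$ is incident with an odd number of edges of $F$ iff $v\in T$; a minimum join has fewest edges, of size $\nu(G,T)$. $(G,T)$ with $G$ bipartite with color classes $A,B$ is comb-bipartite with spine set $A$ and tooth set $B$ if $\nu(G,T)=|B|$. An edge is allowed if it lies in some minimum join; vertices are factor-connected if equal or joined by a path of allowed edges; factor-components are the maximal factor-connected subgrafts; $\mathcal{G}(G,T)$ is the set of factor-components. For a minimum join $F$, let $w_F(e)=-1$ for $e\in F$ and $w_F(e)=1$ otherwise, and $w_F(H)=\sum_{e\in E(H)}w_F(e)$. For $x\neq y$, $d(x,y)$ is the minimum $w_F(P)$ over paths $P$ between $x$ and $y$; $d(x,x)$ is the minimum over circuits containing $x$; this does not depend on the choice of minimum join $F$. For $x,y\in V(G)$, $x\sim_{(G,T)}y$ iff $x,y$ lie in the same factor-component and $d(x,y)=0$; this is an equivalence relation. For $H_1,H_2\in\mathcal{G}(G,T)$, $H_1\trianglelefteq^\circ H_2$ if $H_1=H_2$ or $E_G[V(H_2)\cap A,V(H_1)\cap B]\ne\emptyset$; $\trianglelefteq$ is the reflexive transitive closure of $\trianglelefteq^\circ$ (a partial order). $\mathcal{U}(C)$ denotes the set of strict upper bounds of $C$ in $(\mathcal{G}(G,T),\trianglelefteq)$. $N_G(X)$ is the set of vertices outside $X$ adjacent to a vertex of $X$; $E_G[X,Y]$ is the set of edges with one end in $X$ and the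 other in $Y$. *)

(* Defs.v *)
From mathcomp Require Import all_boot all_order all_algebra.

Set Implicit Arguments.
Unset Strict Implicit.
Unset Printing Implicit Defensive.

(* Finite multigraphs; the pair [ends e] is to be read as unordered. *)
Record mgraph := MGraph {
  vertex : finType;
  edge : finType;
  ends : edge -> vertex * vertex }.

Section Graft.

Variable G : mgraph.
Local Notation V := (vertex G).
Local Notation E := (edge G).

Definition joins (e : E) (x y : V) : bool :=
  (ends e == (x, y)) || (ends e == (y, x)).

Definition edges_between (X Y : {set V}) : {set E} :=
  [set e | [exists x in X, exists y in Y, joins e x y]].

Definition neighbours (X : {set V}) : {set V} :=
  [set y | (y \notin X) && [exists x in X, exists e, joins e x y]].

Definition adj (D : {set E}) : rel V :=
  fun x y => [exists e in D, joins e x y].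

(* A subgraph is the pair of its vertex set and its edge set; the subgraft
   carried by H has H.1 :&: T as its set of odd vertices. *)
Definition subgraph : Type := ({set V} * {set E})%type.

Definition is_subgraph (H : subgraph) : bool :=
  [forall e in H.2, ((ends e).1 \in H.1) && ((ends e).2 \in H.1)].

Definition subgraph_le (H K : subgraph) : bool :=
  (H.1 \subset K.1) && (H.2 \subset K.2).

Definition is_subgraft (T : {set V}) (H : subgraph) : bool :=
  is_subgraph H &&
  [forall x in H.1, ~~ odd #|T :&: [set y | connect (adj H.2) x y]|].

Definition is_graft (T : {set V}) : bool := is_subgraft T (setT, setT).

(* A loop contributes 2. *)
Definition degree (F : {set E}) (v : V) : nat :=
  \sum_(e in F) (((ends e).1 == v) + ((ends e).2 == v)).

Definition join (T : {set V}) (F : {set E}) : bool :=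
  [forall v, odd (degree F v) == (v \in T)].

Definition min_join (T : {set V}) (F : {set E}) : bool :=
  join T F && [forall F' : {set E}, join T F' ==> (#|F| <= #|F'|)].

(* #|E| bounds the size of every join, and a graft always has a join, so the
   default value plays no role. *)
Definition nu (T : {set V}) : nat :=
  \big[minn/#|{: E}|]_(F : {set E} | join T F) #|F|.

Definition color_classes (A B : {set V}) : bool :=
  [&& A :|: B == setT, A :&: B == set0 & edges_between A B == setT].

Definition comb_bipartite (T A B : {set V}) : bool :=
  [&& is_graft T, color_classes A B & nu T == #|B|].

Definition allowed (T : {set V}) : {set E} :=
  [set e | [exists F : {set E}, min_join T F && (e \in F)]].

Definition factor_connected (T : {set V}) : rel V := connect (adj (allowed T)).

Definition factor_connected_subgraft (T : {set V}) (H : subgraph) : bool :=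
  [&& is_subgraft T H, H.1 != set0
    & [forall x in H.1, forall y in H.1, factor_connected T x y]].

Definition factor_components (T : {set V}) : {set subgraph} :=
  [set H | factor_connected_subgraft T H &&
     [forall K : subgraph,
        factor_connected_subgraft T K && subgraph_le H K ==> (K == H)]].

(* A walk from x is the list of its successive (edge, vertex reached) steps. *)
Fixpoint walk (x : V) (p : seq (E * V)) : bool :=
  if p is (e, y) :: p' then joins e x y && walk y p' else true.

Definition walk_end (x : V) (p : seq (E * V)) : V := last x (unzip2 p).

Definition path_between (x y : V) (p : seq (E * V)) : bool :=
  [&& walk x p, walk_end x p == y & uniq (x :: unzip2 p)].

(* The edgeless circuit at x (p = [::]) is admitted: otherwise d(x,x) would be
   undefined for a vertex on no cycle, and ~ would not be reflexive. *)
Definition circuit_through (x : V) (p : seq (E * V)) : bool :=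
  [&& walk x p, walk_end x p == x, uniq (unzip2 p) & uniq (unzip1 p)].

Definition weight (F : {set E}) (p : seq (E * V)) : int :=
  (\sum_(e <- unzip1 p) (if e \in F then -1 else 1 : int))%R.

Definition route (x y : V) (p : seq (E * V)) : bool :=
  if x == y then circuit_through x p else path_between x y p.

(* "d(x,y) = k", computed from the join F. *)
Definition is_dist (F : {set E}) (x y : V) (k : int) : Prop :=
  (exists2 p, route x y p & weight F p = k) /\
  (forall p, route x y p -> (k <= weight F p)%R).

(* d does not depend on the minimum join used to compute it, and a graft has
   a minimum join. *)
Definition sim (T : {set V}) (x y : V) : Prop :=
  (exists2 H, H \in factor_components T & (x \in H.1) && (y \in H.1)) /\
  (forall F, min_join T F -> is_dist F x y 0%R).

Definition sim_class (T : {set V}) (S : {set V}) : Prop :=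
  exists x, forall y, y \in S <-> sim T x y.

Definition tooth_class (T B : {set V}) (C S : {set V}) : Prop :=
  sim_class T S /\ S \subset C :&: B.

Definition below1 (T A B : {set V}) : rel subgraph :=
  fun H1 H2 =>
    [&& H1 \in factor_components T, H2 \in factor_components T
      & (H1 == H2) || (edges_between (H2.1 :&: A) (H1.1 :&: B) != set0)].

Definition below (T A B : {set V}) : rel subgraph := connect (below1 T A B).

Definition strict_upper (T A B : {set V}) (C : subgraph) : {set subgraph} :=
  [set D in factor_components T | below T A B C D && (D != C)].

(* [is_partition_by I U X]: the family (U S) indexed by the S satisfying I
   partitions X, empty members being allowed. *)
Definition is_partition_by (I : {set V} -> Prop)
    (U : {set V} -> {set subgraph}) (X : {set subgraph}) : Prop :=
  [/\ forall S, I S -> U S \subset X,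
      forall D, D \in X -> exists2 S, I S & D \in U S
    & forall S S', I S -> I S' -> S <> S' -> [disjoint U S & U S']].

Definition upper_partition (T A B : {set V}) (C0 : subgraph)
    (U : {set V} -> {set subgraph}) : Prop :=
  [/\ is_partition_by (tooth_class T B C0.1) U (strict_upper T A B C0),
      forall D S, D \in strict_upper T A B C0 ->
        tooth_class T B C0.1 S ->
        neighbours D.1 :&: C0.1 != set0 ->
        neighbours D.1 :&: C0.1 \subset S ->
        D \in U S
    & forall D D' S, D \in strict_upper T A B C0 ->
        tooth_class T B C0.1 S -> D' \in U S ->
        edges_between D.1 D'.1 != set0 ->
        D \in U S].

End Graft.

(* Main.v *)
Require Import Defs.
From mathcomp Require Import all_boot all_order all_algebra.
From mathcomp Require Import zify.
Import Order.TTheory GRing.Theory Num.Theory.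

Set Implicit Arguments.
Unset Strict Implicit.
Unset Printing Implicit Defensive.

(** For a root r, let mu v be the least size of an edge set whose odd-degree
    vertices form T + r + v, so that d(r, v) = mu v - nu(T).  By Sebo's theorem
    every minimum join avoids the boundary of the component containing r of each
    level set {mu <= i}, and crosses the boundary of every other component of it
    exactly once.

    Take r = x in C0 and in B.  The level-zero component K of x contains the
    factor-component of x and is closed downwards in the order; since an edge
    from x to another factor-component is not allowed, K contains no
    factor-component reached from x by going up.  If y in C0 and in B has
    d(x, y) < 0, the component N of y in {d(x, .) < 0} lies in K.  As C0 crosses N
    and minimum joins can be recombined component by component, no other
    factor-component crosses N, so that N is closed upwards outside C0.  Hence
    nothing lies above C0 both through x and through y unless d(x, y) = 0, and
    U(S) consists of what is reached by going up from the vertices of S. *)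

(** * Symmetric differences of finite sets *)

Definition sdiff (X : finType) (P Q : {set X}) : {set X} :=
  [set x | (x \in P) (+) (x \in Q)].

Local Notation "P :+: Q" := (sdiff P Q) (at level 52, left associativity).

Lemma in_sdiff (X : finType) (P Q : {set X}) x :
  (x \in P :+: Q) = (x \in P) (+) (x \in Q).
Proof. by rewrite inE. Qed.

Ltac set_xor :=
  apply/setP => ?; rewrite ?(in_sdiff, in_setI, in_setU, in_setD, in_setC, in_set1, in_set0);
  repeat match goal with
  | |- context [in_mem ?a ?b] => case: (in_mem a b)
  | |- context [eq_op ?a ?b] => case: (eq_op a b)
  end => //.

(** Each element of [Z] lies in exactly one of [P] and [Q], and toggling [Z] in both moves it to the
    other. This exchange is the main tool for comparing minimum edge sets below. *)
Lemma card_sdiff_sub (X : finType) (P Q Z : {set X}) :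
  Z \subset P :+: Q -> #|P :+: Z| + #|Q :+: Z| = #|P| + #|Q|.
Proof.
move=> /subsetP sZ.
have cardE (R : {set X}) : #|R| = \sum_x (x \in R) by rewrite -sum1_card big_mkcond.
rewrite !cardE -!big_split /=; apply: eq_bigr => x _.
have := sZ x; rewrite !in_sdiff.
by case: (x \in Z); case: (x \in P); case: (x \in Q) => //= /(_ isT).
Qed.

Lemma card_sdiff1 (X : finType) (P : {set X}) x :
  #|P :+: [set x]| = if x \in P then #|P|.-1 else #|P|.+1.
Proof.
case: ifP => xP.
  have -> : P :+: [set x] = P :\ x.
    by apply/setP => z; rewrite !inE; case: eqP => [->|_]; rewrite ?xP ?addbF.
  by rewrite (cardsD1 x P) xP.
have -> : P :+: [set x] = x |: P.
  by apply/setP => z; rewrite !inE; case: eqP => [->|_]; rewrite ?xP ?addbF.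
by rewrite cardsU1 xP.
Qed.

Lemma card_sdiff1_le (X : finType) (P : {set X}) x : #|P :+: [set x]| <= #|P|.+1.
Proof. by rewrite card_sdiff1; case: ifP => //; lia. Qed.

Lemma card_sdiff1_in (X : finType) (P : {set X}) x : x \in P -> #|P :+: [set x]|.+1 = #|P|.
Proof. by move=> xP; rewrite card_sdiff1 xP prednK //; apply/card_gt0P; exists x. Qed.

Lemma sdiff_cancel (X : finType) (P Q : {set X}) : P :+: Q :+: Q = P.
Proof. set_xor. Qed.

Lemma connect_ind (X : finType) (r : rel X) (P : X -> Prop) x y :
  connect r x y -> P x -> (forall a b, P a -> r a b -> P b) -> P y.
Proof.
move=> /connectP[p + ->] + step; elim: p x => //= z p IH x /andP[xz zp] Px.
by apply: IH zp _; apply: step xz.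
Qed.

Lemma notin_eqF (X : finType) (K : {set X}) x y : x \notin K -> y \in K -> (x == y) = false.
Proof. by move=> xK yK; apply: contraNF xK => /eqP ->. Qed.

Lemma in_eqF (X : finType) (K : {set X}) x y : x \in K -> y \notin K -> (x == y) = false.
Proof. by move=> xK yK; rewrite eq_sym (notin_eqF yK xK). Qed.

(** * Odd-degree boundaries of edge sets, cuts and recombination *)

Section Boundary.

Variable G : mgraph.
Local Notation V := (vertex G).
Local Notation E := (edge G).
Implicit Types (D J Q : {set E}) (K : {set V}) (e : E).

(** The boundary map over the two-element field: a [T]-join is an edge set with boundary [T]. *)
Definition bd D : {set V} := [set v | odd (degree D v)].
Definition cut K : {set E} := [set e | ((ends e).1 \in K) (+) ((ends e).2 \in K)].
Definition inside K : {set E} := [set e | ((ends e).1 \in K) && ((ends e).2 \in K)].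

Lemma odd_sum (I : finType) (P : pred I) (F : I -> nat) :
  odd (\sum_(i | P i) F i) = \big[addb/false]_(i | P i) odd (F i).
Proof. exact: (big_morph odd oddD). Qed.

Lemma bd_sdiff D J : bd (D :+: J) = bd D :+: bd J.
Proof.
apply/setP => v; rewrite !inE /degree !odd_sum !(big_mkcond (fun e => e \in _)) /=.
rewrite -big_split /=; apply: eq_bigr => e _; rewrite inE.
by case: (e \in D); case: (e \in J) => //=; rewrite ?addbF ?addbb.
Qed.

Lemma bd0 : bd set0 = set0.
Proof. by apply/setP => v; rewrite !inE /degree big_set0. Qed.

Lemma joins_sym e x y : joins e x y = joins e y x.
Proof. by rewrite /joins orbC. Qed.

Lemma joins_ends e : joins e (ends e).1 (ends e).2.
Proof. by rewrite /joins -surjective_pairing eqxx. Qed.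

Lemma joins_end e x y a b : joins e x y -> joins e a b -> y = a \/ y = b.
Proof. by rewrite /joins => /orP[]/eqP-> /orP[]/eqP[] ? ?; subst; auto. Qed.

Lemma bd1 e x y : joins e x y -> bd [set e] = [set x] :+: [set y].
Proof.
move=> exy; apply/setP => v; rewrite !inE /degree big_set1 oddD !oddb.
by case/orP: exy => /eqP -> /=; rewrite ![_ == v]eq_sym // addbC.
Qed.

Lemma joins_cut e x y K : joins e x y -> (e \in cut K) = (x \in K) (+) (y \in K).
Proof. by rewrite inE => /orP[] /eqP -> //=; rewrite addbC. Qed.

Lemma joins_inside e x y K : joins e x y -> (e \in inside K) = (x \in K) && (y \in K).
Proof. by rewrite inE => /orP[] /eqP -> //=; rewrite andbC. Qed.

Lemma cutP e K : e \in cut K -> exists x y, [/\ joins e x y, x \in K & y \notin K].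
Proof.
rewrite inE; case xK: (_ \in K) => /= yK.
  by exists (ends e).1, (ends e).2; rewrite joins_ends.
by exists (ends e).2, (ends e).1; rewrite joins_sym joins_ends yK xK.
Qed.

Lemma odd_card_bd D K : odd #|bd D :&: K| = odd #|D :&: cut K|.
Proof.
have sumE (a : V) : \sum_(v in K) (a == v : nat) = (a \in K).
  rewrite big_mkcond (bigD1 a) //= big1 ?addn0 ?eqxx; first by case: (a \in K).
  by move=> v va; rewrite eq_sym (negbTE va); case: ifP.
have -> : odd #|bd D :&: K| = odd (\sum_(v in K) degree D v).
  rewrite -sum1_card !odd_sum big_mkcond [RHS]big_mkcond; apply: eq_bigr => v _.
  by rewrite !inE; case: (v \in K); case: (odd _).
rewrite /degree exchange_big /= -sum1_card !odd_sum big_mkcond [RHS]big_mkcond.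
apply: eq_bigr => e _; rewrite !inE; case: (e \in D) => //=.
rewrite big_split /= !sumE oddD !oddb.
by case: (_ (+) _).
Qed.

Lemma bd_out D x :
  (forall e y, e \in D -> joins e x y -> False) -> x \notin bd D.
Proof.
move=> H; rewrite inE /degree big1 // => e eD.
case: eqP => [e1|_]; first by case: (H e (ends e).2); rewrite // -e1 joins_ends.
case: eqP => [e2|_] //.
by case: (H e (ends e).1); rewrite // joins_sym -e2 joins_ends.
Qed.

Lemma bd_edge D x : x \in bd D -> exists e y, e \in D /\ joins e x y.
Proof.
move=> xD; have [/exists_inP[e eD /existsP[y exy]]|H] :=
  boolP [exists e in D, exists y, joins e x y]; first by exists e, y.
suff : x \notin bd D by rewrite xD.
apply: bd_out => e y eD exy.
by case/negP: H; apply/exists_inP; exists e => //; apply/existsP; exists y.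
Qed.

Lemma bd_setI_inside D K :
  D :&: cut K = set0 -> bd (D :&: inside K) = bd D :&: K.
Proof.
move=> D0; apply/setP => v.
have DE : D = (D :&: inside K) :+: (D :\: inside K) by set_xor.
rewrite [in RHS]DE bd_sdiff [in RHS]inE in_sdiff; case vK: (v \in K).
  rewrite andbT [X in _ (+) X](negbTE _) ?addbF //.
  apply: bd_out => e y; rewrite inE => /andP[eK eD] evy.
  have : e \in D :&: cut K by rewrite inE eD (joins_cut _ evy) vK; move: eK; rewrite (joins_inside _ evy) vK.
  by rewrite D0 inE.
rewrite andbF; apply/negbTE; apply: bd_out => e y; rewrite inE => /andP[_ eK] evy.
by rewrite (joins_inside _ evy) vK in eK.
Qed.

Lemma bd_setD_inside D K :
  D :&: cut K = set0 -> bd (D :\: inside K) = bd D :\: K.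
Proof.
move=> D0.
have -> : D :\: inside K = D :+: (D :&: inside K) by set_xor.
rewrite bd_sdiff bd_setI_inside //; set_xor.
Qed.

(** Recombination: [D] is kept inside [K], and [J] everywhere else, [cut K] included. *)
Definition mix K D J : {set E} := (D :&: inside K) :|: (J :\: inside K).

Lemma bd_mix K D J : D :&: cut K = set0 -> J :&: cut K = set0 ->
  bd (mix K D J) = (bd D :&: K) :|: (bd J :\: K).
Proof.
move=> D0 J0.
have -> : mix K D J = (D :&: inside K) :+: (J :\: inside K) by set_xor.
by rewrite bd_sdiff bd_setI_inside // bd_setD_inside //; set_xor.
Qed.

Lemma card_mix K D J : #|mix K D J| = #|D :&: inside K| + #|J :\: inside K|.
Proof.
rewrite /mix cardsU; set X := _ :&: _ :&: _.
suff -> : X = set0 by rewrite cards0 subn0.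
by rewrite /X; set_xor.
Qed.

Lemma card_mixC K D J : #|mix K D J| + #|mix K J D| = #|D| + #|J|.
Proof.
rewrite !card_mix -(cardsID (inside K) D) -(cardsID (inside K) J); lia.
Qed.

Lemma adj_sym D : symmetric (adj D).
Proof. by move=> x y; apply: eq_existsb => e; rewrite joins_sym. Qed.

(** The set [Q] stands for a path: only its boundary matters for the parity arguments, so it is
    grown by toggling one edge at a time. *)
Lemma connect_bd D x y :
  connect (adj D) x y -> exists2 Q : {set E}, Q \subset D & bd Q = [set x] :+: [set y].
Proof.
move=> xy.
apply: (connect_ind (P := fun z => exists2 Q : {set E}, Q \subset D & bd Q = [set x] :+: [set z]) xy).
  by exists set0; rewrite ?sub0set // bd0; set_xor.
move=> a b [Q sQ bQ] /exists_inP[e eD eab]; exists (Q :+: [set e]).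
  apply/subsetP => f; rewrite !inE; case: (boolP (f \in Q)) => /= [/(subsetP sQ)//|_].
  by move/eqP->.
by rewrite bd_sdiff bQ (bd1 eab); set_xor.
Qed.

Lemma closed_cut (r : rel V) D x :
  (forall e a b, e \in D -> joins e a b -> r a b) ->
  D :&: cut [set y | connect r x y] = set0.
Proof.
move=> H; apply/setP => e; rewrite in_setI in_set0; apply/negP => /andP[eD /cutP[a [b [eab]]]].
rewrite !inE => xa /negP; apply; apply: connect_trans xa (connect1 _).
exact: H eD eab.
Qed.

(** No edge of [D] leaves the component of [x] in [D], so by the handshake count it contains an even
    number of boundary vertices, hence a second one. *)
Lemma bd_connect D x : x \in bd D ->
  exists y, [/\ y \in bd D, y != x & connect (adj D) x y].
Proof.
move=> xD; set Z := [set y | connect (adj D) x y].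
have D0 : D :&: cut Z = set0.
  by apply: closed_cut => e a b eD eab; apply/exists_inP; exists e.
have := odd_card_bd D Z; rewrite D0 cards0 /= (cardsD1 x).
have -> : x \in bd D :&: Z by rewrite inE xD inE connect0.
rewrite add1n /= => /negbFE od.
have : 0 < #|(bd D :&: Z) :\ x| by case: #|_| od.
case/card_gt0P => y; rewrite in_setD1 in_setI [y \in Z]inE => /and3P[yx yD xy].
by exists y.
Qed.

Lemma bd_path D x X : bd D = [set x] :+: X ->
  exists2 y, y \in X & exists2 Q : {set E}, Q \subset D & bd Q = [set x] :+: [set y].
Proof.
move=> bD; case: (boolP (x \in X)) => xX.
  by exists x => //; exists set0; rewrite ?sub0set // bd0; set_xor.
have xD : x \in bd D by rewrite bD !inE eqxx (negbTE xX).
have [y [yD yx /connect_bd Qxy]] := bd_connect xD; exists y => //.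
by move: yD; rewrite bD !inE (negbTE yx).
Qed.

End Boundary.

Lemma odd_sdiff (X : finType) (P Q : {set X}) :
  odd #|P :+: Q| = odd #|P| (+) odd #|Q|.
Proof.
have cardE (R : {set X}) : #|R| = \sum_(x in X) (x \in R) by rewrite -sum1_card big_mkcond.
rewrite !cardE !odd_sum -big_split /=; apply: eq_bigr => x _.
by rewrite in_sdiff; do 2 case: (x \in _).
Qed.

Lemma odd_set1I (X : finType) (K : {set X}) v : odd #|[set v] :&: K| = (v \in K).
Proof.
have -> : [set v] :&: K = if v \in K then [set v] else set0.
  apply/setP => w; rewrite in_setI in_set1; case: eqP => [->|/eqP wv].
    by case: ifP => vK; rewrite ?vK ?in_set1 ?in_set0 ?eqxx.
  by case: ifP => _; rewrite ?in_set1 ?in_set0 // (negbTE wv).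
by case: ifP; rewrite ?cards1 ?cards0.
Qed.

Lemma leq_exchange a b c d : a + b = c + d -> c <= b -> a <= d.
Proof. lia. Qed.

(** * Level sets of [mu] and Sebo's theorem *)

Section Levels.

Variables (G : mgraph) (B T0 : {set vertex G}).
Local Notation V := (vertex G).
Local Notation E := (edge G).
Implicit Types (D J M Q : {set E}) (K : {set V}) (e : E) (u v w : V).

Hypothesis bip : cut B = setT.

(** With [T0] equal to [T + r], these are the edge sets whose least size is [mu v]. *)
Definition isj v J := bd J == T0 :+: [set v].

Definition minj v J := isj v J && [forall J' : {set E}, isj v J' ==> (#|J| <= #|J'|)].

(** The bound is strict: with [n = nu(T)], [lev n.+1] is the set where [d <= 0] and [lev n] the set
    where [d < 0]. A vertex without any such edge set lies in no level. *)
Definition lev i : {set V} := [set v | [exists J : {set E}, isj v J && (#|J| < i)]].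

Definition levr i : rel V :=
  fun x y => [&& x \in lev i, y \in lev i & [exists e, joins e x y]].

Definition levcomp i v : {set V} := [set w | connect (levr i) v w].

Definition good K := forall v J, v \in K -> minj v J -> J :&: cut K = set0.

Lemma minj_isj v J : minj v J -> isj v J.
Proof. by case/andP. Qed.

Lemma minj_le v J J' : minj v J -> isj v J' -> #|J| <= #|J'|.
Proof. by case/andP => _ /forallP/(_ J')/implyP. Qed.

Lemma minjP v J : isj v J -> (forall J', isj v J' -> #|J| <= #|J'|) -> minj v J.
Proof. by move=> vJ H; rewrite /minj vJ; apply/forallP => J'; apply/implyP/H. Qed.

Lemma isj_minj_le v J M : minj v M -> isj v J -> #|J| <= #|M| -> minj v J.
Proof. by move=> vM vJ le; apply: minjP => // J' /(minj_le vM); apply: leq_trans. Qed.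

Lemma minj_ex v J : isj v J -> exists M, minj v M.
Proof.
move=> vJ; case: (arg_minnP (fun J : {set E} => #|J|) vJ) => M vM le.
by exists M; apply: minjP.
Qed.

Lemma isj_path u v J Q : isj v J -> bd Q = [set v] :+: [set u] -> isj u (J :+: Q).
Proof. by move=> /eqP vJ bQ; rewrite /isj bd_sdiff vJ bQ; apply/eqP; set_xor. Qed.

Lemma isj_edge u v J e : isj v J -> joins e v u -> isj u (J :+: [set e]).
Proof. by move=> vJ /bd1; apply: isj_path. Qed.

Lemma minj_lev i v J : minj v J -> (v \in lev i) = (#|J| < i).
Proof.
move=> vJ; rewrite inE; apply/existsP/idP => [[J' /andP[vJ']]|lt].
  exact: leq_ltn_trans (minj_le vJ vJ').
by exists J; rewrite (minj_isj vJ).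
Qed.

Lemma isj_lev i v J : isj v J -> #|J| < i -> v \in lev i.
Proof. by move=> vJ lt; rewrite inE; apply/existsP; exists J; rewrite vJ. Qed.

Lemma lev_minj i v : v \in lev i -> exists2 M, minj v M & #|M| < i.
Proof.
move=> vi; have := vi; rewrite inE => /existsP[J /andP[/minj_ex[M vM] _]].
by exists M; rewrite // -(minj_lev i vM).
Qed.

Lemma lev_mono i j : i <= j -> lev i \subset lev j.
Proof.
move=> ij; apply/subsetP => v /lev_minj[M vM lt]; rewrite (minj_lev j vM).
exact: leq_trans ij.
Qed.

Lemma odd_cut_isj v J K : isj v J ->
  odd #|J :&: cut K| = odd #|T0 :&: K| (+) (v \in K).
Proof.
move=> /eqP vJ; rewrite -odd_card_bd vJ.
have -> : (T0 :+: [set v]) :&: K = (T0 :&: K) :+: ([set v] :&: K) by set_xor.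
by rewrite odd_sdiff odd_set1I.
Qed.

(** Every edge crosses [B], so the size of an edge set has the parity of its crossings of [B], which
    its boundary determines. *)
Lemma odd_isj u v J M : isj u J -> isj v M ->
  odd #|J| (+) odd #|M| = (u \in B) (+) (v \in B).
Proof.
move=> /(@odd_cut_isj _ _ B) + /(@odd_cut_isj _ _ B); rewrite bip !setIT => -> ->.
by do ! case: (_ \in _); case: odd.
Qed.

Lemma bip_joins e u v : joins e u v -> (u \in B) (+) (v \in B).
Proof. by move=> /(@joins_cut _ _ _ _ B) <-; rewrite bip inE. Qed.

(** Toggling the edge changes [mu] by at most one, and parity excludes equality. *)
Lemma minj_adj e u v J M : joins e u v -> minj u J -> minj v M ->
  #|J| = #|M|.+1 \/ #|M| = #|J|.+1.
Proof.
move=> euv uJ vM.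
have h1 := minj_le vM (isj_edge (minj_isj uJ) euv).
have h2 : #|J| <= #|M :+: [set e]|.
  by apply: minj_le uJ (isj_edge (minj_isj vM) _); rewrite joins_sym.
have := odd_isj (minj_isj uJ) (minj_isj vM); rewrite (bip_joins euv).
have := card_sdiff1_le J e; have := card_sdiff1_le M e.
case: (ltngtP #|J| #|M|) => [lt|lt|->]; last by rewrite addbb.
  by right; lia.
by left; lia.
Qed.

Lemma levr_sym i : connect_sym (levr i).
Proof.
apply: sym_connect_sym => x y; rewrite /levr andbCA; congr [&& _, _ & _].
by apply: eq_existsb => e; rewrite joins_sym.
Qed.

Lemma comp_refl i v : v \in levcomp i v.
Proof. by rewrite inE connect0. Qed.

Lemma comp_lev i v w : v \in lev i -> w \in levcomp i v -> w \in lev i.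
Proof.
move=> vi; rewrite inE => vw; apply: (connect_ind (P := fun z => z \in lev i) vw) => //.
by move=> a b _ /and3P[].
Qed.

Lemma comp_adj i v e a b :
  v \in lev i -> a \in levcomp i v -> joins e a b -> b \in lev i -> b \in levcomp i v.
Proof.
move=> vi av eab bi; move: (av); rewrite !inE => va; apply: connect_trans va (connect1 _).
by rewrite /levr (comp_lev vi av) bi; apply/existsP; exists e.
Qed.

Lemma comp_eq i v w : w \in levcomp i v -> levcomp i w = levcomp i v.
Proof.
rewrite inE => vw; apply/setP => z; rewrite !inE.
by apply/idP/idP; apply: connect_trans; rewrite // levr_sym.
Qed.

Lemma comp_mono i j v : i <= j -> levcomp i v \subset levcomp j v.
Proof.
move=> ij; apply/subsetP => w; rewrite !inE; apply: connect_sub => a b /and3P[ai bi ab].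
by apply: connect1; rewrite /levr !(subsetP (lev_mono ij)).
Qed.

Lemma cut_comp i v e : v \in lev i -> e \in cut (levcomp i v) ->
  exists x y, [/\ joins e x y, x \in levcomp i v, x \in lev i & y \notin lev i].
Proof.
move=> vi /cutP[x [y [exy xv yv]]]; exists x, y; split=> //; first exact: comp_lev xv.
by apply: contra yv; apply: comp_adj exy.
Qed.

Lemma isj_mix K u v J M : good K -> u \in K -> v \in K -> minj u J -> minj v M ->
  isj u (mix K J M).
Proof.
move=> gK uK vK uJ vM.
rewrite /isj bd_mix; [|exact: gK uJ|exact: gK vM].
rewrite (eqP (minj_isj uJ)) (eqP (minj_isj vM)); apply/eqP/setP => x.
rewrite ?(in_sdiff, in_setI, in_setU, in_setD, in_set1).
case: (boolP (x \in K)) => xK; rewrite ?andbT ?andbF ?orbF //=.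
by rewrite (notin_eqF xK uK) (notin_eqF xK vK).
Qed.

(** The two recombinations of [J] and [M] have total size [#|J| + #|M|], and the other one serves
    [v], so it is at least as large as [M]. *)
Lemma minj_mix K u v J M : good K -> u \in K -> v \in K -> minj u J -> minj v M ->
  minj u (mix K J M).
Proof.
move=> gK uK vK uJ vM; apply: (isj_minj_le uJ); first exact: isj_mix uJ vM.
have := minj_le vM (isj_mix gK vK uK vM uJ); have := card_mixC K J M; lia.
Qed.

Lemma good_odd K u : good K -> u \in K -> (exists M, isj u M) -> odd #|T0 :&: K|.
Proof.
move=> gK uK [M0 /minj_ex[M uM]].
have := odd_cut_isj K (minj_isj uM); rewrite (gK _ _ uK uM) cards0 uK addbT /=.
by case: odd.
Qed.

(* If J crossed K twice, the part of J leading from v to its first crossing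
   e1 = (p, t) could be exchanged with a minimum p-join, producing a minimum
   p-join that still crosses K. *)
Lemma good_once K u v J : good K -> u \in K -> (exists M, isj u M) ->
  v \notin K -> minj v J -> exists g, J :&: cut K = [set g].
Proof.
move=> gK uK exu vK vJ; have oT := good_odd gK uK exu.
case: exu => M0 /minj_ex[M uM].
apply/cards1P; have := odd_cut_isj K (minj_isj vJ); rewrite oT (negbTE vK) addbF /=.
case: (ltngtP #|J :&: cut K| 1) => [||//]; first by case: #|_|.
move=> /card_gt1P[e1' [e2' [e1X' e2X' e12']]] _; exfalso.
set X := J :&: cut K in e1X' e2X'.
have M0cut := gK _ _ uK uM.
(* Without its crossing edges, and corrected by [M], [J] no longer crosses [K]. The part of the
   result outside [K] yields a path [Q] from [v] to the outer end [t] of a crossing edge. *)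
set O := J :+: X :+: M.
have Ocut : O :&: cut K = set0.
  apply/setP => e; move/setP/(_ e): M0cut.
  by rewrite /O /X !(in_sdiff, in_setI, in_set0); case: (e \in cut K); rewrite ?andbF // !andbT => ->; case: (e \in J).
set D := O :\: inside K.
have bD : bd D = [set v] :+: (bd X :\: K).
  rewrite bd_setD_inside // /O !bd_sdiff (eqP (minj_isj vJ)) (eqP (minj_isj uM)).
  apply/setP => x; rewrite ?(in_sdiff, in_setI, in_setU, in_setD, in_set1).
  case: (boolP (x \in K)) => /= xK.
    by rewrite (in_eqF xK vK).
  rewrite (notin_eqF xK uK).
  by rewrite addbF; case: (_ == _); case: (_ \in T0); case: (_ \in _).
have [t] := bd_path bD; rewrite in_setD => /andP[tK tX] [Q sQ bQ].
have [e1 [p [e1X e1tp]]] := bd_edge tX.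
have pK : p \in K.
  by move: e1X; rewrite in_setI (joins_cut _ e1tp) (negbTE tK) => /andP[].
have [e2 e2X e12] : exists2 e2, e2 \in X & e2 != e1.
  by have [<-|] := eqVneq e1' e1; [exists e2'; rewrite // eq_sym | exists e1'].
have notQ e : e \in X -> e \notin Q.
  move=> eX; apply: contraTN (eX) => eQ; have := subsetP sQ _ eQ; rewrite in_setD => /andP[_ eO].
  by apply: contra_eqN Ocut => ?; apply/set0Pn; exists e; rewrite in_setI eO; move: eX; rewrite in_setI => /andP[].
set Z := Q :+: [set e1].
have bZ : bd Z = [set v] :+: [set p] by rewrite bd_sdiff bQ (bd1 e1tp); set_xor.
have pN : isj p (J :+: Z) := isj_path (minj_isj vJ) bZ.
have [M1 pM1] := minj_ex pN.
(* Off [inside K] this minimum set for [p] agrees with [M], and it avoids the cut, so all of [Z]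
   lies in its difference with [J]. *)
have pM : minj p (mix K M1 M) := minj_mix gK pK uK pM1 uM.
have sZ : Z \subset J :+: mix K M1 M.
  apply/subsetP => e; rewrite [e \in Z]in_sdiff in_set1; case: (eqVneq e e1) => [-> _|ne].
    move: (e1X); rewrite in_setI => /andP[e1J e1c]; rewrite in_sdiff e1J.
    by move/setP/(_ e1): (gK _ _ pK pM); rewrite in_setI e1c andbT in_set0 => ->.
  rewrite addbF => eQ; have := subsetP sQ _ eQ.
  rewrite /D /O /mix !(in_sdiff, in_setD, in_setU, in_setI) => /andP[/negbTE->].
  have : e \notin X by apply: contraL eQ; apply: notQ.
  rewrite in_setI => /negbTE->.
  by rewrite andbF addbF andTb.
have vM : isj v (mix K M1 M :+: Z).
  by apply: isj_path (minj_isj pM) _; rewrite bZ; set_xor.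
(* By exchange [J :+: Z] is minimum for [p], yet it keeps the second crossing edge [e2]. *)
have le : #|J :+: Z| <= #|mix K M1 M|.
  exact: leq_exchange (card_sdiff_sub sZ) (minj_le vJ vM).
have /setP/(_ e2) := gK _ _ pK (isj_minj_le pM pN le).
rewrite !(in_sdiff, in_setI, in_set1, in_set0) (negbTE e12) (negbTE (notQ _ e2X)).
by move: e2X; rewrite in_setI => /andP[-> ->].
Qed.


(* Walking from v to x inside the level set, this ends with a minimum x-join
   using an edge from x to a higher level, which is absurd. *)
Lemma minj_edge_step i e x y v v' f J :
  (forall w, w \in lev i -> good (levcomp i w)) ->
  joins e x y -> x \in lev i.+1 -> y \notin lev i.+1 ->
  v \in lev i.+1 -> v' \in lev i.+1 -> joins f v v' ->
  minj v J -> e \in J -> exists2 J', minj v' J' & e \in J'.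
Proof.
move=> IH exy xi yi vi v'i fvv' vJ eJ.
have y_large N : isj y N -> i < #|N|.
  by move=> yN; rewrite ltnNge; apply: contra yi; rewrite -ltnS; apply: isj_lev yN.
have x_large N : isj x N -> i <= #|N|.
  move=> xN; have := y_large _ (isj_edge xN exy); have := card_sdiff1_le N e; clear; lia.
have [J' v'J' J'i] := lev_minj v'i.
have fe : f != e.
  apply: contraNneq yi => fe; rewrite fe in fvv'.
  by case: (joins_end exy fvv') => ->.
have Ji : #|J| < i.+1 by rewrite -(minj_lev i.+1 vJ).
(* If [mu] increases along [f], toggling [f] in [J] suffices. Otherwise [v'] lies in the lower level
   set, where the induction hypothesis applies to its component. *)
case: (minj_adj fvv' vJ v'J') => szJ; last first.
  exists (J :+: [set f]); last by rewrite in_sdiff eJ in_set1 eq_sym (negbTE fe).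
  apply: isj_minj_le v'J' (isj_edge (minj_isj vJ) fvv') _.
  by rewrite szJ card_sdiff1_le.
have v'li : v' \in lev i by rewrite (minj_lev i v'J') -ltnS -szJ.
set K := levcomp i v'.
have gK : good K := IH _ v'li.
have v'K : v' \in K := comp_refl i v'.
have eK : e \notin inside K.
  rewrite (joins_inside _ exy) negb_and; apply/orP; right.
  by apply: contra yi => /(comp_lev v'li); apply: (subsetP (lev_mono (leqnSn i))).
have [Jlt|Jge] := ltnP #|J| i.
  have vK : v \in K.
    by apply: comp_adj v'K _ _; rewrite ?v'li // 1?joins_sym ?(minj_lev i vJ) //; exact: fvv'.
  exists (mix K J' J); first exact: minj_mix v'J' vJ.
  by rewrite in_setU in_setD eK eJ orbT.
(* Now [mu v = i], so [v] lies outside [K] and [J] crosses into [K] by a single edge [g]. *)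
have Jeq : #|J| = i by apply/eqP; rewrite eqn_leq -ltnS Ji.
have vK : v \notin K.
  by apply: contraTN Jge => /(comp_lev v'li); rewrite (minj_lev i vJ) -ltnNge.
have exv' : exists M, isj v' M by exists J'; apply: minj_isj.
have [g Jg] := good_once gK v'K exv' vK vJ.
have : g \in J :&: cut K by rewrite Jg set11.
rewrite in_setI => /andP[gJ gc].
have [k [p [gkp kK pK]]] := cutP gc.
have ki := comp_lev v'li kK.
have pi : p \in lev i.+1.
  have [M kM Mi] := lev_minj ki.
  apply: isj_lev (isj_edge (minj_isj kM) gkp) _; have := card_sdiff1_le M g; move: Mi; clear; lia.
have [M0 kM0 M0i] := lev_minj ki.
have J'cut := gK _ _ v'K v'J'.
have gJ' : g \notin J' by move/setP/(_ g): J'cut; rewrite in_setI gc andbT in_set0 => ->.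
set M := mix K M0 J'.
have kM : minj k M := minj_mix gK kK v'K kM0 v'J'.
have Mi : #|M| < i by rewrite -(minj_lev i kM).
case: (boolP (e \in J')) => eJ'; first by exists J'.
(* Outside [K] and apart from [g], the difference of [J] and [J'] has boundary [v + p]. Deleting [e]
   from it adds [x + y], so a part [Q] avoiding [e] leads from [v] to [p], [x] or [y]. *)
set D0 := (J :+: [set g] :+: J') :\: inside K.
have D0cut : (J :+: [set g] :+: J') :&: cut K = set0.
  apply/setP => d; move/setP/(_ d): J'cut; move/setP/(_ d): Jg.
  rewrite !(in_sdiff, in_setI, in_set0, in_set1).
  by case: (d \in cut K); rewrite ?andbF // !andbT => <- ->; rewrite addbb.
have bD0 : bd D0 = [set v] :+: [set p].
  rewrite bd_setD_inside // !bd_sdiff (bd1 gkp) (eqP (minj_isj vJ)) (eqP (minj_isj v'J')).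
  apply/setP => z; rewrite ?(in_sdiff, in_setD, in_set1).
  case: (boolP (z \in K)) => /= zK.
    by rewrite (in_eqF zK vK) (in_eqF zK pK).
  rewrite (notin_eqF zK kK) (notin_eqF zK v'K).
  by case: (_ == v); case: (_ == p); case: (_ \in T0).
have bD : bd (D0 :+: [set e]) = [set v] :+: ([set p] :+: ([set x] :+: [set y])).
  by rewrite bd_sdiff bD0 (bd1 exy); set_xor.
have eg : e != g.
  apply: contraNneq yi => eg; rewrite -eg in gkp.
  by case: (joins_end exy gkp) => ->; rewrite // (subsetP (lev_mono (leqnSn i))).
have eD0 : e \in D0.
  by rewrite in_setD eK !in_sdiff eJ (negbTE eJ') in_set1 (negbTE eg).
have [t tX [Q sQ bQ]] := bd_path bD.
have eQ : e \notin Q.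
  by apply/negP => /(subsetP sQ); rewrite in_sdiff eD0 set11.
have sQD0 d : d \in Q -> d \in D0.
  move=> dQ; have := subsetP sQ _ dQ; rewrite in_sdiff in_set1.
  by case: eqP => [de|_]; [rewrite de (negbTE eQ) in dQ | rewrite addbF].
have gQ : g \notin Q.
  by apply/negP => /sQD0; rewrite in_setD !in_sdiff gJ set11 (negbTE gJ') andbF.
have sQJ : Q \subset J :+: J'.
  apply/subsetP => d dQ; have := sQD0 _ dQ; rewrite in_setD !in_sdiff in_set1.
  by case: (eqVneq d g) => [dg|_]; [rewrite dg (negbTE gQ) in dQ | rewrite addbF => /andP[]].
have sQM : Q \subset J :+: M.
  apply/subsetP => d dQ; have := sQD0 _ dQ; have := subsetP sQJ _ dQ.
  by rewrite /M /D0 !(in_sdiff, in_setD, in_setU, in_setI) => + /andP[/negbTE-> _]; rewrite andbF.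
have szQJ := card_sdiff_sub sQJ; have szQM := card_sdiff_sub sQM.
have tJ : isj t (J :+: Q) := isj_path (minj_isj vJ) bQ.
have tJ' : isj t (J' :+: [set f] :+: Q).
  by apply: isj_path bQ; apply: isj_edge (minj_isj v'J') _; rewrite joins_sym.
have swapf : J' :+: [set f] :+: Q = J' :+: Q :+: [set f] by set_xor.
have lef := card_sdiff1_le (J' :+: Q) f; rewrite swapf in tJ'.
have eJQ : e \in J :+: Q by rewrite in_sdiff eJ (negbTE eQ).
have : [|| t == p, t == x | t == y].
  by move: tX; rewrite !(in_sdiff, in_set1); do ! case: (_ == _).
case/or3P => /eqP tE; subst t.
(* If [Q] ends at [p], the exchange makes [N] minimum for [k], still with [e] in it. Recombining it
   with [J'] inside [K] gives the required set for [v']. *)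
- set N := J :+: Q :+: [set g].
  have gJQ : g \in J :+: Q by rewrite in_sdiff gJ (negbTE gQ).
  have kN : isj k N by apply: isj_edge tJ _; rewrite joins_sym.
  have vM : isj v (M :+: [set g] :+: Q).
    apply: isj_path (isj_edge (minj_isj kM) gkp) _.
    by rewrite bQ; set_xor.
  have Nmin : minj k N.
    apply: isj_minj_le kM kN _; have := minj_le vJ vM.
    have -> : M :+: [set g] :+: Q = M :+: Q :+: [set g] by set_xor.
    have := card_sdiff1_le (M :+: Q) g; have := card_sdiff1_in gJQ; rewrite -/N; move: szQM Jeq; clear; lia.
  exists (mix K J' N); first exact: minj_mix v'J' Nmin.
  by rewrite in_setU in_setD eK in_sdiff eJQ in_set1 (negbTE eg) orbT.
(* If [Q] ends at [x] or [y], the sizes of [J :+: Q] and [J' :+: Q] add up to [2i - 1], whereas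
   [mu x >= i] and [mu y > i], used after deleting [e] or toggling [f], force at least [2i + 1]. *)
- have h1 := y_large _ (isj_edge tJ exy); have h2 := x_large _ tJ'.
  have := card_sdiff1_in eJQ; move: h1 h2 lef szQJ szJ Jeq; clear; lia.
- have h1 := y_large _ tJ; have h2 := y_large _ tJ'; move: h1 h2 lef szQJ szJ Jeq; clear; lia.
Qed.

(** First half of Sebo's theorem, by induction on the level. If a minimum set for a vertex of the
    component used an edge [e] leaving it at [x], walking to [x] would keep [e], and deleting [e]
    would then put its outer end into the same level set. *)
Lemma comp_good i v : v \in lev i -> good (levcomp i v).
Proof.
elim: i v => [v|i IH v vi]; first by rewrite inE => /existsP[J]; rewrite ltn0 andbF.
move=> u J uK uJ; apply/eqP/set0Pn => -[e]; rewrite in_setI => /andP[eJ ec].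
have [x [y [exy xK xi yi]]] := cut_comp vi ec.
have ux : connect (levr i.+1) u x by have := xK; rewrite -(comp_eq uK) inE.
have [N xN eN] : exists2 N, minj x N & e \in N.
  apply: (connect_ind (P := fun z => exists2 N, minj z N & e \in N) ux); first by exists J.
  move=> a b [N aN eN] /and3P[ai bi /existsP[f fab]].
  exact: (minj_edge_step IH exy xi yi ai bi fab aN eN).
case/negP: yi; apply: isj_lev (isj_edge (minj_isj xN) exy) _.
have := minj_lev i.+1 xN; rewrite xi; have := card_sdiff1_in eN; clear; lia.
Qed.

End Levels.

(** * Allowed edges and factor-classes against level components *)

Section FactorClasses.

Variables (G : mgraph) (B T : {set vertex G}) (F0 : {set edge G}).
Local Notation V := (vertex G).
Local Notation E := (edge G).
Implicit Types (F J M : {set E}) (e : E) (x y z a b : V).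

Hypothesis bip : cut B = setT.
Hypothesis F0min : min_join T F0.
Local Notation n := #|F0|.
Local Notation rooted x := (T :+: [set x]).

Lemma joinE F : join T F = (bd F == T).
Proof.
apply/forallP/eqP => [H|<- v]; last by rewrite inE.
by apply/setP => v; rewrite inE (eqP (H v)).
Qed.

(** The root cancels, so minimum joins are the minimum sets for the root itself and the results on
    levels apply to them. *)
Lemma isj_root x F : isj (rooted x) x F = join T F.
Proof. by rewrite joinE /isj sdiff_cancel. Qed.

Lemma min_joinE x F : min_join T F = minj (rooted x) x F.
Proof.
by rewrite /min_join /minj isj_root; congr (_ && _); apply: eq_forallb => J; rewrite isj_root.
Qed.

Lemma min_join_card F : min_join T F -> #|F| = n.
Proof.
case/andP => jF /forallP mF; case/andP: F0min => jF0 /forallP mF0.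
by apply/eqP; rewrite eqn_leq (implyP (mF _)) // (implyP (mF0 _)).
Qed.

Lemma join_ge F : join T F -> n <= #|F|.
Proof. by case/andP: F0min => _ /forallP H; apply/implyP. Qed.

Lemma join_min F : join T F -> #|F| <= n -> min_join T F.
Proof.
by move=> jF le; rewrite /min_join jF; apply/forallP => J; apply/implyP => /join_ge; apply: leq_trans.
Qed.

Lemma allowedP e : reflect (exists2 F, min_join T F & e \in F) (e \in allowed T).
Proof. by rewrite inE; apply: exists_inP. Qed.

Lemma root_lev x : x \in lev (rooted x) n.+1.
Proof. by apply: (@isj_lev _ _ _ _ F0); rewrite // isj_root; case/andP: F0min. Qed.

Lemma root_notin_lev x : x \notin lev (rooted x) n.
Proof. by apply/negP => /lev_minj[F /minj_isj]; rewrite isj_root => /join_ge; lia. Qed.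

Lemma lev_sym i x y : (y \in lev (rooted x) i) = (x \in lev (rooted y) i).
Proof.
rewrite !inE; apply: eq_existsb => J; congr (_ && _); rewrite /isj; congr (_ == _).
by set_xor.
Qed.

Lemma lev_adj T0 i e x y : x \in lev T0 i -> joins e x y -> y \in lev T0 i.+1.
Proof.
move=> /lev_minj[J xJ lt] exy; apply: isj_lev (isj_edge (minj_isj xJ) exy) _.
by rewrite ltnS; apply: leq_trans (card_sdiff1_le J e) _.
Qed.

Lemma odd_rooted x y J : isj (rooted x) y J -> odd #|J| = odd n (+) (x \in B) (+) (y \in B).
Proof.
move=> yJ; have jF0 : isj (rooted x) x F0 by rewrite isj_root; case/andP: F0min.
have := odd_isj bip yJ jF0; case: (odd #|J|); case: (odd n); case: (x \in B); by case: (y \in B).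
Qed.

(** Between different colours [d] is odd, so [d <= 0] improves to [d < 0]. Within one colour it is
    even, and in [lev_same] [d < 0] improves to [d <= -2]. *)
Lemma lev_opposite x y : (x \in B) (+) (y \in B) ->
  y \in lev (rooted x) n.+1 -> y \in lev (rooted x) n.
Proof.
move=> xy /lev_minj[J yJ lt]; rewrite (minj_lev n yJ).
have := odd_rooted (minj_isj yJ); rewrite -addbA xy addbT => od.
by rewrite ltn_neqAle -ltnS lt andbT; apply: contra_eqN od => /eqP ->; case: odd.
Qed.

Lemma lev_same x y : (x \in B) = (y \in B) ->
  y \in lev (rooted x) n -> y \in lev (rooted x) n.-1.
Proof.
move=> xy /lev_minj[J yJ lt]; rewrite (minj_lev n.-1 yJ).
have := odd_rooted (minj_isj yJ); rewrite -addbA xy addbb addbF => od.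
rewrite ltn_neqAle -ltnS prednK ?lt ?andbT; last by apply: leq_ltn_trans lt.
by apply: contra_eqN od => /eqP ->; case: #|F0| lt => //= m _; case: odd.
Qed.

Definition zerocomp x := levcomp (rooted x) n.+1 x.

Definition factor_class x := [set y | factor_connected T x y].

Lemma factor_class_refl x : x \in factor_class x.
Proof. by rewrite inE; apply: connect0. Qed.

Lemma factor_sym : connect_sym (adj (allowed T)).
Proof. by apply: sym_connect_sym; apply: adj_sym. Qed.

Lemma factor_closed (X : {set V}) x y :
  allowed T :&: cut X = set0 -> x \in X -> factor_connected T x y -> y \in X.
Proof.
move=> X0 xX xy; apply: (connect_ind (P := fun z => z \in X) xy) => // a b aX /exists_inP[e ea eab].
by move/setP/(_ e): X0; rewrite in_setI ea (joins_cut _ eab) aX in_set0 /= => /negbFE.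
Qed.

Lemma factor_crossing (X : {set V}) x y : x \in X -> y \notin X -> factor_connected T x y ->
  exists e a b, [/\ e \in allowed T, e \in cut X, joins e a b & factor_connected T x a].
Proof.
move=> xX yX xy.
pose P e := exists a b, [/\ e \in allowed T, e \in cut X, joins e a b & factor_connected T x a].
have [[yX' _]|//] : (y \in X /\ factor_connected T x y) \/ exists e, P e; last first.
  by rewrite yX' in yX.
apply: (connect_ind (P := fun z => (z \in X /\ factor_connected T x z) \/ exists e, P e) xy).
  by left; split=> //; apply: connect0.
move=> a b [[aX xa]|H] ab; last by right.
have /exists_inP[e ea eab] := ab.
case: (boolP (b \in X)) => bX; [left | right].
  by split=> //; apply: connect_trans xa (connect1 ab).
by exists e, a, b; rewrite (joins_cut _ eab) aX (negbTE bX).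
Qed.

Lemma zerocomp_allowed x : allowed T :&: cut (zerocomp x) = set0.
Proof.
apply/setP => e; rewrite in_setI in_set0; apply/negP => /andP[/allowedP[F mF eF] ec].
have /setP/(_ e) := comp_good bip (root_lev x) (comp_refl _ _ _) (etrans (esym (min_joinE x F)) mF).
by rewrite in_setI eF ec in_set0.
Qed.

Lemma zerocomp_factor x y z : y \in zerocomp x -> factor_connected T y z -> z \in zerocomp x.
Proof. exact: factor_closed (zerocomp_allowed x). Qed.

Lemma zerocomp_refl x : x \in zerocomp x.
Proof. exact: comp_refl. Qed.

Lemma zerocomp_lev x y : y \in zerocomp x -> y \in lev (rooted x) n.+1.
Proof. exact: comp_lev (root_lev x). Qed.

(** By parity [d(x, a) < 0], so a neighbour of [a] is still at distance at most 0. This makes the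
    component closed downwards in the order. *)
Lemma zerocomp_down x a b e : (x \in B) (+) (a \in B) ->
  a \in zerocomp x -> joins e a b -> b \in zerocomp x.
Proof.
move=> xa ax eab; apply: (comp_adj (root_lev x) ax eab).
by apply: lev_adj eab; apply: lev_opposite xa (zerocomp_lev ax).
Qed.

(** Otherwise [d(x, a) < 0] by parity, and toggling [e] in a minimum set for [a] gives a minimum
    join through [e], so that [e] is allowed. *)
Lemma zerocomp_unallowed x a e : joins e x a -> ~~ factor_connected T x a -> a \notin zerocomp x.
Proof.
move=> exa; apply: contra => /zerocomp_lev/(lev_opposite (bip_joins bip exa)).
move=> /lev_minj[M aM lt]; apply: connect1; apply/exists_inP; exists e => //.
have jM : join T (M :+: [set e]).
  by rewrite -(isj_root x); apply: isj_edge (minj_isj aM) _; rewrite joins_sym.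
apply/allowedP; exists (M :+: [set e]).
  by apply: join_min jM _; apply: leq_trans (card_sdiff1_le M e) lt.
rewrite in_sdiff set11; case: (boolP (e \in M)) => // eM.
have := join_ge jM; have := card_sdiff1_in eM; lia.
Qed.

Lemma factor_cut x : allowed T :&: cut (factor_class x) = set0.
Proof.
by apply: closed_cut => e a b eT eab; apply/exists_inP; exists e.
Qed.

Lemma min_join_factor_cut x F : min_join T F -> F :&: cut (factor_class x) = set0.
Proof.
move=> mF; apply/setP => e; move/setP/(_ e): (factor_cut x); rewrite !in_setI in_set0.
case: (boolP (e \in F)) => //= eF <-.
by rewrite (_ : e \in allowed T = true) //; apply/allowedP; exists F.
Qed.

(* Minimum joins can be recombined class by class, so two classes crossing a
   set would yield a minimum join crossing it twice. *)
Lemma single_crossing x y e1 e2 a1 b1 a2 b2 :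
  y \in lev (rooted x) n -> let N := levcomp (rooted x) n y in
  e1 \in allowed T -> e1 \in cut N -> joins e1 a1 b1 ->
  e2 \in allowed T -> e2 \in cut N -> joins e2 a2 b2 ->
  factor_connected T a1 a2.
Proof.
move=> yn N e1a e1N e1ab e2a e2N e2ab; apply: contraT => na.
have [[F1 mF1 e1F1] [F2 mF2 e2F2]] := (allowedP _ e1a, allowedP _ e2a).
set H := factor_class a1.
have jmix F F' : min_join T F -> min_join T F' -> join T (mix H F F').
  move=> mF mF'; rewrite joinE bd_mix ?min_join_factor_cut //.
  case/andP: mF; case/andP: mF'; rewrite !joinE => /eqP-> _ /eqP-> _.
  by apply/eqP; set_xor.
have mM : min_join T (mix H F1 F2).
  apply: join_min; first exact: jmix.
  have := join_ge (jmix _ _ mF2 mF1); have := card_mixC H F1 F2.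
  rewrite (min_join_card mF1) (min_join_card mF2); clear; lia.
have e1H : e1 \in inside H.
  have := min_join_factor_cut a1 mF1 => /setP/(_ e1); rewrite in_setI e1F1 in_set0 /=.
  by rewrite (joins_cut _ e1ab) (joins_inside _ e1ab) factor_class_refl /= => /negbFE.
have e2H : e2 \notin inside H.
  by rewrite (joins_inside _ e2ab) negb_and [a2 \in H]inE na.
have xN : x \notin N by apply: contra (root_notin_lev x) => /(comp_lev yn).
have exy : exists M, isj (rooted x) y M.
  by have [M yM _] := lev_minj yn; exists M; apply: minj_isj.
have xM : minj (rooted x) x (mix H F1 F2) by rewrite -min_joinE.
have [g Hg] := good_once (comp_good bip yn) (comp_refl _ _ y) exy xN xM.
have : e1 \in [set g] by rewrite -Hg in_setI e1N in_setU in_setI e1F1 e1H.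
have : e2 \in [set g] by rewrite -Hg in_setI e2N in_setU in_setD e2F2 e2H orbT.
by rewrite !in_set1 => /eqP e2g /eqP e1g; rewrite e1g -e2g (negbTE e2H) in e1H.
Qed.

(** The class of [x] crosses [N], since it contains [y] inside and [x] outside. By [single_crossing]
    no other class crosses [N]. *)
Lemma comp_factor x y a b : y \in lev (rooted x) n -> factor_connected T x y ->
  let N := levcomp (rooted x) n y in
  a \in N -> ~~ factor_connected T x a -> factor_connected T a b -> b \in N.
Proof.
move=> yn xy N aN xa ab; apply: contraT => bN.
have xN : x \notin N by apply: contra (root_notin_lev x) => /(comp_lev yn).
have [e [c [d [ea ec ecd ac]]]] := factor_crossing aN bN ab.
have yx : factor_connected T y x by rewrite /factor_connected factor_sym.
have [e' [c' [d' [e'a e'c e'cd yc']]]] := factor_crossing (comp_refl _ _ y) xN yx.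
have cc' : factor_connected T c' c := single_crossing yn e'a e'c e'cd ea ec ecd.
case/negP: xa; apply: connect_trans xy _; apply: connect_trans yc' _.
by apply: connect_trans cc' _; rewrite factor_sym.
Qed.

(** By parity [d(x, b) <= -2], so every neighbour of [b] is still at negative distance. *)
Lemma comp_up x y b a e : y \in lev (rooted x) n -> (x \in B) = (b \in B) ->
  b \in levcomp (rooted x) n y -> joins e b a -> a \in levcomp (rooted x) n y.
Proof.
move=> yn xb bN eba; apply: (comp_adj yn bN eba).
have n_gt0 : 0 < n by have [M _] := lev_minj yn; apply: leq_ltn_trans.
by rewrite -(prednK n_gt0); apply: lev_adj eba; apply: lev_same (comp_lev yn bN).
Qed.

(** Along an edge [mu] grows by at most one, so the level at which the edge leaves a component is
    one more than [mu] of its lower end, and the component is that of the lower end. *)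
Lemma cut_comp_uniq T0 i j v w e : v \in lev T0 i -> w \in lev T0 j ->
  e \in cut (levcomp T0 i v) -> e \in cut (levcomp T0 j w) -> levcomp T0 i v = levcomp T0 j w.
Proof.
wlog ij : i j v w / i <= j.
  by move=> H vi wj ev ew; case/orP: (leq_total i j) => ij; [|symmetry]; apply: H.
move=> vi wj ev ew.
have [a [b [eab aK ai bi]]] := cut_comp vi ev.
have [c [d [ecd cK cj dj]]] := cut_comp wj ew.
have [[ca db]|[_ da]] : (c = a /\ d = b) \/ (c = b /\ d = a); last by rewrite da (subsetP (lev_mono _ ij)) in dj.
  have /orP[/eqP|/eqP] := eab; have /orP[/eqP->|/eqP->] := ecd => -[-> ->]; auto.
subst c d.
have [J aJ Ji] := lev_minj ai.
have bJ := lev_adj (i := #|J|.+1) (isj_lev (minj_isj aJ) (leqnn _)) eab.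
have jJ : j <= #|J|.+1.
  by rewrite leqNgt; apply: contra dj => lt; apply: (subsetP (lev_mono _ lt)).
have ijE : i = j by apply/eqP; rewrite eqn_leq ij; apply: leq_trans jJ Ji.
by subst j; rewrite -(comp_eq aK) (comp_eq cK).
Qed.

(* Every edge lies in the boundary of exactly one level component, every such
   boundary contains at most one edge of F0, and J meets it if F0 does. *)
Lemma level_zero_trans x y z : factor_connected T x y -> factor_connected T x z ->
  y \notin lev (rooted x) n -> z \notin lev (rooted x) n -> z \notin lev (rooted y) n.
Proof.
move=> xy xz yn zn; apply/negP => /lev_minj[J zJ]; apply/negP; rewrite -leqNgt.
set T0 := rooted x.
have bJ : bd J = T :+: [set y] :+: [set z] by apply/eqP/(minj_isj zJ).
have jF0 : join T F0 by case/andP: F0min.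
have bF0 : bd F0 = T by apply/eqP; rewrite -joinE.
have y0 := zerocomp_factor (zerocomp_refl x) xy.
have z0 := zerocomp_factor (zerocomp_refl x) xz.
(* Levels up to [n] contain neither [y] nor [z]; at higher levels both lie in the component of
   [x]. *)
have yz i v : v \in lev T0 i -> (y \in levcomp T0 i v) = (z \in levcomp T0 i v).
  move=> vi; have [le|lt] := leqP i n.
    have out w : w \notin lev T0 n -> (w \in levcomp T0 i v) = false.
      by move=> wn; apply: contraNF wn => /(comp_lev vi); apply: (subsetP (lev_mono _ le)).
    by rewrite !out.
  have [y1 z1] := (subsetP (comp_mono T0 x lt) _ y0, subsetP (comp_mono T0 x lt) _ z0).
  rewrite !inE in y1 z1 *; apply/idP/idP => /connect_trans; apply.
    by apply: connect_trans z1; rewrite levr_sym.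
  by apply: connect_trans y1; rewrite levr_sym.
have meets i v e : v \in lev T0 i -> e \in F0 -> e \in cut (levcomp T0 i v) ->
    F0 :&: cut (levcomp T0 i v) = [set e] /\ exists d, d \in J :&: cut (levcomp T0 i v).
  move=> vi eF ec; set K := levcomp T0 i v in ec *.
  have xF0 : minj T0 x F0 by rewrite -min_joinE.
  have exv : exists M, isj T0 v M by have [M /minj_isj vM _] := lev_minj vi; exists M.
  have xK : x \notin K.
    apply: contraL ec => xK; have /setP/(_ e) := comp_good bip vi xK xF0.
    by rewrite in_setI eF in_set0 => /= ->.
  have [g Hg] := good_once (comp_good bip vi) (comp_refl _ _ v) exv xK xF0.
  have eg : e = g by apply/set1P; rewrite -Hg in_setI eF.
  split; first by rewrite eg.
  apply/card_gt0P; suff : odd #|J :&: cut K| by case: #|_|.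
  (* As [y] and [z] lie on the same side of [K], [J] crosses [K] with the parity of [F0], that is,
     an odd number of times. *)
  rewrite -odd_card_bd bJ.
  have -> : (T :+: [set y] :+: [set z]) :&: K = bd F0 :&: K :+: ([set y] :&: K) :+: ([set z] :&: K).
    by rewrite bF0; set_xor.
  by rewrite !odd_sdiff !odd_set1I (yz _ _ vi) -addbA addbb addbF odd_card_bd Hg cards1.
(* Levels exist only within [R], and no edge leaves [R]. The edges are therefore compared inside
   [R], and recombination along [R] turns this into a bound on [#|J|]. *)
set R := [set v | [exists M, isj T0 v M]].
have Rcut : cut R = set0.
  apply/setP => e; rewrite in_set0; apply/negP => /cutP[a [b [eab]]].
  rewrite !inE => /existsP[M aM] /existsPn/(_ (M :+: [set e]))/negP; apply.
  exact: isj_edge eab.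
have levR i : lev T0 i \subset R.
  apply/subsetP => v /lev_minj[M vM _]; rewrite inE; apply/existsP; exists M.
  exact: minj_isj.
(* The premise stands under the existential so that choice yields a function [h] on all edges. *)
have partner e : exists d, e \in F0 :&: inside R ->
    exists i v, [/\ v \in lev T0 i, e \in cut (levcomp T0 i v) & d \in J :&: cut (levcomp T0 i v)].
  case: (boolP (e \in _)); last by exists e.
  rewrite in_setI => /andP[eF eR].
  have exy := joins_ends e; move: eR; rewrite (joins_inside _ exy).
  move=> /andP[]; rewrite !inE => /existsP[M0 /minj_ex[M1 aM1]] /existsP[M2 /minj_ex[M3 bM3]].
  have : exists i v, v \in lev T0 i /\ e \in cut (levcomp T0 i v).
    have aux a b M M' : joins e a b -> minj T0 a M -> minj T0 b M' -> #|M'| = #|M|.+1 ->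
        exists i v, v \in lev T0 i /\ e \in cut (levcomp T0 i v).
      move=> eab aM bM' sz; exists #|M|.+1, a.
      have ai : a \in lev T0 #|M|.+1 := isj_lev (minj_isj aM) (leqnn _).
      split=> //; rewrite (joins_cut _ eab) comp_refl /=.
      by apply/negP => /(comp_lev ai); rewrite (minj_lev _ bM') sz ltnn.
    case: (minj_adj bip exy aM1 bM3) => sz; last exact: aux exy aM1 bM3 sz.
    by apply: aux bM3 aM1 sz; rewrite joins_sym.
  move=> [i [v [vi ev]]]; have [_ [d dJ]] := meets _ _ _ vi eF ev.
  by exists d => _; exists i, v.
have [h hP] := fin_all_exists partner.
have le1 : #|F0 :&: inside R| <= #|J :&: inside R|.
  rewrite -(card_in_imset (f := h)).
    apply: subset_leq_card; apply/subsetP => d /imsetP[e /hP[i [v [vi _ dJ]]] ->].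
    move: dJ; rewrite !in_setI => /andP[-> dc] /=.
    have [a [b [eab _ ai _]]] := cut_comp vi dc.
    rewrite (joins_inside _ eab) (subsetP (levR i)) //=.
    move/setP/(_ (h e)): Rcut; rewrite (joins_cut _ eab) (subsetP (levR i)) // in_set0 /=.
    by move/negbFE.
  move=> e e' eF e'F hE.
  have [i [v [vi ev +]]] := hP _ eF; have [j [w [wj e'w +]]] := hP _ e'F.
  rewrite hE !in_setI => /andP[_ dw] /andP[_ dv].
  have KK := cut_comp_uniq vi wj dv dw.
  have [F1 _] := meets _ _ e vi (subsetP (subsetIl _ _) _ eF) ev.
  apply/esym/set1P; rewrite -F1 in_setI KK e'w andbT.
  exact: (subsetP (subsetIl _ _) _ e'F).
have cut0 (D : {set E}) : D :&: cut R = set0 by rewrite Rcut setI0.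
have yR : y \in R by apply: (subsetP (levR n.+1)); apply: zerocomp_lev.
have zR : z \in R by apply: (subsetP (levR n.+1)); apply: zerocomp_lev.
have jM : join T (mix R F0 J).
  rewrite joinE bd_mix // bF0 bJ; apply/eqP/setP => t.
  rewrite !(in_sdiff, in_setI, in_setU, in_setD, in_set1).
  case: (boolP (t \in R)) => tR; rewrite ?andbT ?andbF ?orbF //=.
  by rewrite (notin_eqF tR yR) (notin_eqF tR zR) !addbF.
have := join_ge jM; rewrite card_mix.
have := cardsID (inside R) F0; have := cardsID (inside R) J; move: le1; clear; lia.
Qed.

End FactorClasses.

(** * Walks, paths and circuits as edge sets *)

Section Walks.

Variable G : mgraph.
Local Notation V := (vertex G).
Local Notation E := (edge G).
Implicit Types (F D : {set E}) (x y : V) (p : seq (E * V)).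

Definition walk_edges p : {set E} := [set e in unzip1 p].

Lemma walk_edges_cons e y p : uniq (unzip1 ((e, y) :: p)) ->
  walk_edges ((e, y) :: p) = walk_edges p :+: [set e].
Proof.
move=> /= /andP[ep _]; apply/setP => d; rewrite in_sdiff /walk_edges !inE.
by case: eqP => [->|_]; rewrite ?(negbTE ep) ?addbF.
Qed.

Lemma bd_walk x p : walk x p -> uniq (unzip1 p) ->
  bd (walk_edges p) = [set x] :+: [set walk_end x p].
Proof.
elim: p x => [x _ _|[e y] p IH x].
  have -> : walk_edges [::] = set0 by apply/setP => d; rewrite /walk_edges !inE.
  by rewrite bd0; set_xor.
move=> /= /andP[exy yp] up; rewrite walk_edges_cons // bd_sdiff (IH y) //; last by case/andP: up.
by rewrite (bd1 exy) /walk_end /=; set_xor.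
Qed.

Lemma walk_mem y p e x z : walk y p -> e \in unzip1 p -> joins e x z -> x \in y :: unzip2 p.
Proof.
elim: p y => [|[d w] p IH] y //= /andP[dyw wp].
rewrite in_cons => /orP[/eqP-> exz|ep exz].
  rewrite joins_sym in exz.
  by case: (joins_end exz dyw) => ->; rewrite !inE eqxx ?orbT.
by rewrite in_cons (IH w) ?orbT.
Qed.

Lemma walk_uniq x p : walk x p -> uniq (x :: unzip2 p) -> uniq (unzip1 p).
Proof.
elim: p x => [|[e y] p IH] x //= /andP[exy yp] /andP[xp up].
rewrite (IH y) // andbT; apply: contra xp => ep.
exact: walk_mem yp ep exy.
Qed.

Lemma route_bd x y p : route x y p ->
  uniq (unzip1 p) /\ bd (walk_edges p) = [set x] :+: [set y].
Proof.
rewrite /route; case: eqP => [->|_].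
  by move=> /and4P[wp /eqP we _ up]; rewrite (bd_walk wp up) we.
move=> /and3P[wp /eqP we up]; have up1 := walk_uniq wp up.
by rewrite (bd_walk wp up1) we.
Qed.

(** Toggling the edges of [p] in [F] removes those of weight -1 and adds those of weight 1. *)
Lemma weightE F p : uniq (unzip1 p) ->
  (weight F p = #|F :+: walk_edges p|%:Z - #|F|%:Z)%R.
Proof.
rewrite /weight; elim: p => [|[e y] p IH] up.
  have -> : walk_edges [::] = set0 by apply/setP => d; rewrite /walk_edges !inE.
  have -> : F :+: set0 = F by set_xor.
  by rewrite big_nil subrr.
rewrite walk_edges_cons //= big_cons; case/andP: up => ep up.
have -> : F :+: (walk_edges p :+: [set e]) = F :+: walk_edges p :+: [set e] by set_xor.
rewrite IH // card_sdiff1.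
have -> : (e \in F :+: walk_edges p) = (e \in F).
  by rewrite in_sdiff /walk_edges inE (negbTE ep) addbF.
case: ifP => eF; last by clear; lia.
have : 0 < #|F :+: walk_edges p|.
  by apply/card_gt0P; exists e; rewrite in_sdiff eF /walk_edges inE (negbTE ep).
clear; lia.
Qed.

Lemma path_walk D x s : path (adj D) x s ->
  exists p, [/\ walk x p, unzip2 p = s & walk_edges p \subset D].
Proof.
elim: s x => [x _|y s IH x /= /andP[/exists_inP[e eD exy] /IH[p [wp p2 pD]]]].
  by exists [::]; split=> //; apply/subsetP => d; rewrite /walk_edges !inE.
exists ((e, y) :: p); rewrite /= exy wp p2; split=> //.
apply/subsetP => d; rewrite /walk_edges !inE => /predU1P[-> //|dp].
by apply: (subsetP pD); rewrite /walk_edges inE.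
Qed.

Lemma connect_path D x y : connect (adj D) x y ->
  exists2 p, path_between x y p & walk_edges p \subset D.
Proof.
move=> /connectP[s0 xs0 ->]; case: (shortenP xs0) => s xs us _.
have [p [wp p2 pD]] := path_walk xs.
by exists p; rewrite // /path_between wp /walk_end p2 eqxx us.
Qed.

End Walks.

(** * Existence of joins and description of the factor-components *)

Section Grafts.

Variables (G : mgraph) (T : {set vertex G}).
Local Notation V := (vertex G).
Local Notation E := (edge G).

(** An edge set whose boundary differs from [T] at the fewest vertices is a join: by evenness a
    wrong vertex has another one in its connected component, and toggling a path between them
    corrects both. *)
Lemma graft_min_join : is_graft T -> exists F, min_join T F.
Proof.
move=> /andP[_ /forall_inP evT].
suff [J0 jJ0] : exists J, join T J.
  case: (arg_minnP (fun J : {set E} => #|J|) jJ0) => F jF le; exists F.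
  by rewrite /min_join jF; apply/forallP => J; apply/implyP/le.
case: (@arg_minnP _ set0 predT (fun J : {set E} => #|bd J :+: T|)) => // J _ le.
exists J; rewrite joinE; case: (set_0Vmem (bd J :+: T)) => [J0|[x xJ]].
  by apply/eqP/setP => v; move/setP/(_ v): J0; rewrite in_sdiff in_set0; do 2 case: (v \in _).
set Z := [set y | connect (adj setT) x y].
have cZ : J :&: cut Z = set0.
  by apply: closed_cut => e a b _ eab; apply/exists_inP; exists e.
have : ~~ odd #|(bd J :+: T) :&: Z|.
  have -> : (bd J :+: T) :&: Z = (bd J :&: Z) :+: (T :&: Z) by set_xor.
  by rewrite odd_sdiff odd_card_bd cZ cards0 /= evT // inE.
have xZ : x \in Z by rewrite inE.
rewrite (cardsD1 x) in_setI xJ xZ add1n /= negbK => od.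
have /card_gt0P[y] : 0 < #|(bd J :+: T) :&: Z :\ x| by case: #|_| od.
rewrite in_setD1 in_setI [y \in Z]inE => /and3P[yx yJ /connect_bd[Q _ bQ]].
have := le (J :+: Q) isT; rewrite bd_sdiff bQ.
have -> : bd J :+: ([set x] :+: [set y]) :+: T = bd J :+: T :+: [set x] :+: [set y] by set_xor.
have yJx : y \in bd J :+: T :+: [set x] by rewrite in_sdiff yJ in_set1 (negbTE yx).
have := card_sdiff1_in xJ; have := card_sdiff1_in yJx; clear; lia.
Qed.

Lemma edges_betweenP (X Y : {set V}) :
  reflect (exists e a b, [/\ a \in X, b \in Y & joins e a b]) (edges_between X Y != set0).
Proof.
apply: (iffP (set0Pn _)) => [[e]|[e [a [b [aX bY eab]]]]].
  by rewrite inE => /exists_inP[a aX /exists_inP[b bY eab]]; exists e, a, b.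
by exists e; rewrite inE; apply/exists_inP; exists a => //; apply/exists_inP; exists b.
Qed.

Lemma fcomp_conn H x y : H \in factor_components T -> x \in H.1 -> y \in H.1 ->
  factor_connected T x y.
Proof.
by rewrite inE => /andP[/and3P[_ _ /forall_inP hc] _] /hc /forall_inP; apply.
Qed.

Hypothesis grT : is_graft T.

(** All edges inside the class are taken, allowed or not, since maximality also concerns edges. *)
Definition class_graft x : subgraph G := (factor_class T x, inside (factor_class T x)).

Lemma class_graftP x : factor_connected_subgraft T (class_graft x).
Proof.
have [F mF] := graft_min_join grT.
have bF : bd F = T by apply/eqP; rewrite -joinE; case/andP: mF.
set C := factor_class T x; apply/and3P; split.
- apply/andP; split; first by apply/forall_inP => e; rewrite inE.
  apply/forall_inP => y yC; set Z := [set _ | _].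
  have ZC z : z \in Z -> z \in C.
    rewrite inE => yz; apply: (connect_ind (P := fun w => w \in C) yz) => // a b _.
    by case/exists_inP => e; rewrite /= => eC eab; move: eC; rewrite (joins_inside _ eab) => /andP[].
  (* A minimum join does not leave the class, and its edges inside the class belong to the subgraph,
     so it does not cross the component [Z]. *)
  rewrite -bF odd_card_bd (_ : F :&: cut Z = set0) ?cards0 //.
  apply/setP => e; rewrite in_setI in_set0; apply/negP => /andP[eF /cutP[a [b [eab aZ bZ]]]].
  case/negP: bZ; rewrite inE; move: (aZ); rewrite inE => ya.
  apply: connect_trans ya (connect1 _); apply/exists_inP; exists e => //=.
  move/setP/(_ e): (min_join_factor_cut x mF); rewrite in_setI eF in_set0 /=.
  by rewrite (joins_cut _ eab) (joins_inside _ eab) ZC //= => /negbFE.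
- by apply/set0Pn; exists x; apply: factor_class_refl.
apply/forall_inP => a; rewrite inE => xa; apply/forall_inP => b; rewrite inE => xb.
by apply: connect_trans xb; rewrite factor_sym.
Qed.

Lemma subgraft_class K x : factor_connected_subgraft T K -> x \in K.1 ->
  subgraph_le K (class_graft x).
Proof.
move=> /and3P[/andP[/forall_inP sK _] _ /forall_inP cK] xK.
have sub : K.1 \subset factor_class T x.
  by apply/subsetP => y yK; rewrite inE; move/forall_inP: (cK _ xK); apply.
apply/andP; split=> //=; apply/subsetP => e /sK /andP[e1 e2].
by rewrite inE !(subsetP sub).
Qed.

Lemma subgraph_le_antisym (H K : subgraph G) : subgraph_le H K -> subgraph_le K H -> H = K.
Proof.
case: H K => [a b] [c d] /andP[/= ac bd'] /andP[/= ca db].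
by congr (_, _); apply/eqP; rewrite eqEsubset ?ac ?ca ?bd' ?db.
Qed.

Lemma class_graft_fcomp x : class_graft x \in factor_components T.
Proof.
rewrite inE class_graftP; apply/forallP => K; apply/implyP => /andP[fK le].
apply/eqP/subgraph_le_antisym => //; apply: subgraft_class fK _.
by case/andP: le => /subsetP/(_ x) + _; apply; apply: factor_class_refl.
Qed.

Lemma fcompE H x : H \in factor_components T -> x \in H.1 -> H = class_graft x.
Proof.
rewrite inE => /andP[fH /forallP/(_ (class_graft x)) mH] xH.
by apply/esym/eqP; apply: (implyP mH); rewrite class_graftP subgraft_class.
Qed.

Lemma fcomp_eq H K x y : H \in factor_components T -> K \in factor_components T ->
  x \in H.1 -> y \in K.1 -> factor_connected T x y -> H = K.
Proof.
move=> fH fK xH yK xy; rewrite (fcompE fH xH); apply/esym/fcompE => //.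
rewrite (fcompE fK yK); by rewrite inE /factor_connected factor_sym.
Qed.

End Grafts.

(** * Zero distance in terms of level sets *)

Section Sim.

Variables (G : mgraph) (B T : {set vertex G}) (F0 : {set edge G}).
Local Notation V := (vertex G).
Local Notation E := (edge G).
Hypothesis bip : cut B = setT.
Hypothesis F0min : min_join T F0.
Local Notation n := #|F0|.
Local Notation rooted x := (T :+: [set x]).

Lemma route_isj F x y p : join T F -> route x y p ->
  isj (rooted x) y (F :+: walk_edges p).
Proof.
by move=> jF /route_bd[_ bp]; apply: isj_path bp; rewrite isj_root.
Qed.

(** For [x != y] a path is extracted from [F :+: J]. Toggling it in [J] leaves a join, at least as
    large as [F], and the exchange bounds the other side by [#|J|]. For [x = y] the empty circuit
    serves. *)
Lemma isj_route F x y J : min_join T F -> isj (rooted x) y J ->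
  exists2 p, route x y p & #|F :+: walk_edges p| <= #|J|.
Proof.
move=> mF yJ; have [xy|xy] := eqVneq x y.
  exists [::]; first by rewrite /route xy eqxx /circuit_through /= /walk_end /= eqxx.
  rewrite (_ : F :+: _ = F); last first.
    by apply/setP => e; rewrite in_sdiff /walk_edges inE /= addbF.
  rewrite -xy isj_root in yJ.
  by case/andP: mF => _ /forallP/(_ J)/implyP; apply.
have jF : join T F by case/andP: mF.
have bFJ : bd (F :+: J) = [set x] :+: [set y].
  by rewrite bd_sdiff (eqP yJ); move: jF; rewrite joinE => /eqP->; set_xor.
have xFJ : x \in bd (F :+: J) by rewrite bFJ in_sdiff !in_set1 eqxx (negbTE xy).
have [z [zFJ zx cz]] := bd_connect xFJ.
have zy : z = y by move: zFJ; rewrite bFJ in_sdiff !in_set1 (negbTE zx) => /eqP.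
rewrite zy in cz; have [p pp sp] := connect_path cz.
have rp : route x y p by rewrite /route (negbTE xy).
exists p => //; apply: leq_exchange (card_sdiff_sub sp) _.
have [_ bp] := route_bd rp.
have jJp : join T (J :+: walk_edges p).
  by rewrite -(isj_root T x); apply: isj_path yJ _; rewrite bp; set_xor.
by case/andP: mF => _ /forallP/(_ (J :+: walk_edges p))/implyP; apply.
Qed.

Lemma is_dist0 F x y : min_join T F -> y \in lev (rooted x) n.+1 ->
  is_dist F x y 0%R <-> y \notin lev (rooted x) n.
Proof.
move=> mF yn1; have jF : join T F by case/andP: mF.
have nF : #|F| = n := min_join_card F0min mF.
split.
  move=> [_ ge0]; apply/negP => /lev_minj[J /minj_isj yJ Jn].
  have [p rp le] := isj_route mF yJ; have := ge0 _ rp.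
  have [up _] := route_bd rp.
  rewrite weightE // nF; move: le Jn; clear; lia.
move=> yn.
have ge p : route x y p -> n <= #|F :+: walk_edges p|.
  move=> /(route_isj jF) yJ; rewrite leqNgt; apply: contra yn.
  exact: isj_lev yJ.
split=> [|p rp]; last first.
  have [up _] := route_bd rp; have := ge _ rp.
  by rewrite weightE // nF; clear; lia.
have [J /minj_isj yJ Jn] := lev_minj yn1.
have [p rp le] := isj_route mF yJ; exists p => //.
have [up _] := route_bd rp; have := ge _ rp.
rewrite weightE // nF; move: le Jn; clear; lia.
Qed.

Lemma simP H x y : H \in factor_components T -> x \in H.1 -> y \in H.1 ->
  sim T x y <-> y \notin lev (rooted x) n.
Proof.
move=> fH xH yH.
have yn1 : y \in lev (rooted x) n.+1.
  apply: (zerocomp_lev F0min).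
  exact: (zerocomp_factor bip F0min (zerocomp_refl T F0 x) (fcomp_conn fH xH yH)).
split=> [[_ /(_ _ F0min)]|yn]; first by move/(is_dist0 F0min yn1).
split; first by exists H; rewrite // xH yH.
by move=> F mF; apply/(is_dist0 mF yn1).
Qed.

End Sim.

(** * Going up from the vertices of [C0] *)

Section Upper.

Variables (G : mgraph) (T A B : {set vertex G}) (C0 : subgraph G) (F0 : {set edge G}).
Local Notation V := (vertex G).
Local Notation E := (edge G).
Local Notation rooted x := (T :+: [set x]).
Local Notation n := #|F0|.
Hypothesis colAB : color_classes A B.
Hypothesis grT : is_graft T.
Hypothesis F0min : min_join T F0.
Hypothesis fC0 : C0 \in factor_components T.

Lemma color_compl x : (x \in A) = (x \notin B).
Proof.
case/and3P: colAB => /eqP/setP/(_ x) + /eqP/setP/(_ x) + _.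
by rewrite !inE; case: (x \in A); case: (x \in B).
Qed.

Lemma cut_color : cut B = setT.
Proof.
case/and3P: colAB => _ _ /eqP/setP eAB; apply/setP => e; rewrite in_setT.
have := eAB e; rewrite inE in_setT => /exists_inP[a aA /exists_inP[b bB eab]].
by rewrite (joins_cut _ eab) bB addbT -color_compl.
Qed.

Local Notation bip := cut_color.

(** A step upwards that avoids [C0], the one class that may cross a negative component without being
    contained in it. *)
Definition upr : rel (subgraph G) :=
  fun D D' => [&& below1 T A B D D', D != C0 & D' != C0].

(** Reachability upwards from a single vertex [b] of [C0], by a chain that never meets [C0]
    again. *)
Definition up (b : V) (D : subgraph G) : bool :=
  [exists H : subgraph G, [&& H \in factor_components T, H != C0,
    edges_between (H.1 :&: A) [set b] != set0 & connect upr H D]].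

Lemma upP b D : up b D -> exists H e a,
  [/\ H \in factor_components T, H != C0, a \in H.1, joins e a b & connect upr H D].
Proof.
move=> /existsP[H /and4P[fH HC /edges_betweenP[e [a [b' [aH b'b eab]]]] HD]].
exists H, e, a; split=> //; first by move: aH; rewrite inE => /andP[].
by move: b'b eab; rewrite inE => /eqP ->.
Qed.

Lemma upr_edge D D' : upr D D' -> D = D' \/
  exists e a b, [/\ a \in D'.1, b \in D.1, a \in A, b \in B & joins e a b].
Proof.
move=> /and3P[/and3P[_ _ /orP[/eqP DD|/edges_betweenP[e [a [b [aD bD eab]]]]]] _ _]; first by left.
right; exists e, a, b; move: aD bD; rewrite !inE => /andP[? ?] /andP[? ?].
by split.
Qed.

Lemma outside_class x D a : x \in C0.1 -> D \in factor_components T -> D != C0 ->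
  a \in D.1 -> ~~ factor_connected T x a.
Proof.
move=> xC fD DC aD; apply: contra DC => xa; apply/eqP/esym.
exact: fcomp_eq fC0 fD xC aD xa.
Qed.

Lemma upr_fcomp D D' : upr D D' -> D \in factor_components T /\ D' \in factor_components T.
Proof. by move=> /and3P[/and3P[]]. Qed.

Lemma zerocomp_sub x D b : D \in factor_components T -> b \in D.1 ->
  b \in zerocomp T F0 x -> D.1 \subset zerocomp T F0 x.
Proof.
move=> fD bD bx; apply/subsetP => c cD.
exact: (zerocomp_factor bip F0min bx (fcomp_conn fD bD cD)).
Qed.

Lemma zerocomp_upr x D D' : x \in B -> upr D D' ->
  D'.1 \subset zerocomp T F0 x -> D.1 \subset zerocomp T F0 x.
Proof.
move=> xB DD' sD'; have [fD fD'] := upr_fcomp DD'.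
case: (upr_edge DD') => [->//|[e [a [b [aD' bD aA bB eab]]]]].
apply: (zerocomp_sub fD bD).
apply: (zerocomp_down bip F0min _ (subsetP sD' _ aD') eab).
by rewrite xB /= -color_compl.
Qed.

(** The step goes along an edge from a tooth [b] of [D], of the colour of [x], so [comp_up] brings
    its other end into the component and [comp_factor] brings in the rest of [D']. *)
Lemma levcomp_upr x y D D' : x \in B -> x \in C0.1 -> y \in C0.1 ->
  y \in lev (rooted x) n -> upr D D' ->
  D.1 \subset levcomp (rooted x) n y -> D'.1 \subset levcomp (rooted x) n y.
Proof.
move=> xB xC yC yn DD' sD; have [fD fD'] := upr_fcomp DD'.
case: (upr_edge DD') => [<-//|[e [a [b [aD' bD aA bB eab]]]]].
apply/subsetP => c cD'.
have aN : a \in levcomp (rooted x) n y.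
  apply: (comp_up bip F0min yn _ (subsetP sD _ bD)); first by rewrite xB bB.
  by rewrite joins_sym; exact: eab.
apply: (comp_factor bip F0min yn (fcomp_conn fC0 xC yC) aN _ (fcomp_conn fD' aD' cD')).
by case/and3P: DD' => _ _ D'C; apply: outside_class xC fD' D'C aD'.
Qed.

(** Descending the chain would put its first member into the component, against [zerocomp_unallowed]
    for the edge from [x] to that member. *)
Lemma zerocomp_up x D : x \in B -> x \in C0.1 -> up x D -> ~~ (D.1 \subset zerocomp T F0 x).
Proof.
move=> xB xC /upP[H [e [a [fH HC aH eax HD]]]]; apply/negP => sD.
have sH : H.1 \subset zerocomp T F0 x.
  pose P (K : subgraph G) := K.1 \subset zerocomp T F0 x -> H.1 \subset zerocomp T F0 x.
  have base : P H by [].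
  refine (connect_ind (P := P) HD base _ sD).
  by move=> K K' IH KK' sK'; apply: IH; apply: zerocomp_upr KK' sK'.
rewrite joins_sym in eax.
by have := zerocomp_unallowed bip F0min eax (outside_class xC fH HC aH); rewrite (subsetP sH).
Qed.

(** If [d(x, y) < 0], everything above [y] stays in the negative component of [y], hence in the zero
    component of [x], which contains nothing above [x]. *)
Lemma up_same_class x y D : x \in B -> x \in C0.1 -> y \in B -> y \in C0.1 ->
  up x D -> up y D -> y \notin lev (rooted x) n.
Proof.
move=> xB xC yB yC xD /upP[H [e [a [fH HC aH eay HD]]]]; apply/negP => yn.
have xy := fcomp_conn fC0 xC yC.
have yN : y \in levcomp (rooted x) n y := comp_refl _ _ _.
have aN : a \in levcomp (rooted x) n y.
  by apply: (comp_up bip F0min yn _ yN); rewrite ?xB ?yB // joins_sym; exact: eay.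
have sH : H.1 \subset levcomp (rooted x) n y.
  apply/subsetP => c cH.
  exact: (comp_factor bip F0min yn xy aN (outside_class xC fH HC aH) (fcomp_conn fH aH cH)).
have sD : D.1 \subset levcomp (rooted x) n y.
  apply: (connect_ind (P := fun K : subgraph G => K.1 \subset levcomp (rooted x) n y) HD) => // K K' sK KK'.
  exact: levcomp_upr xB xC yC yn KK' sK.
case/negP: (zerocomp_up xB xC xD); apply: subset_trans sD _.
have y0 : y \in zerocomp T F0 x := zerocomp_factor bip F0min (zerocomp_refl T F0 x) xy.
by rewrite /zerocomp -(comp_eq y0); apply: comp_mono.
Qed.

Lemma up_strict_upper b D : b \in B -> b \in C0.1 -> up b D -> D \in strict_upper T A B C0.
Proof.
move=> bB bC /existsP[H /and4P[fH HC /edges_betweenP[e [a [b' [aH b'b eab]]]] HD]].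
rewrite inE; apply: (connect_ind (P := fun K : subgraph G => is_true ((K \in factor_components T) && (below T A B C0 K && (K != C0)))) HD).
  rewrite fH HC andbT; apply: connect1; rewrite /below1 fC0 fH /=; apply/orP; right.
  apply/edges_betweenP; exists e, a, b; split=> //; first by rewrite inE bC.
  by move: b'b eab; rewrite inE => /eqP ->.
move=> K K' /and3P[fK CK KC] KK'; have [_ ->] := upr_fcomp KK'.
case/and3P: KK' => KK' _ ->; rewrite andbT.
exact: connect_trans CK (connect1 KK').
Qed.

Lemma up_step b D D' : up b D -> upr D D' -> up b D'.
Proof.
move=> /existsP[H /and4P[fH HC bH HD]] DD'; apply/existsP; exists H.
by rewrite fH HC bH; apply: connect_trans HD (connect1 DD').
Qed.

Lemma up_first b a e D : D \in factor_components T -> D != C0 ->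
  a \in D.1 -> a \in A -> joins e a b -> up b D.
Proof.
move=> fD DC aD aA eab; apply/existsP; exists D; rewrite fD DC connect0 andbT /=.
by apply/edges_betweenP; exists e, a, b; rewrite !inE aD aA.
Qed.

(** After its last visit to [C0], a chain starts with an edge at a tooth of [C0]; that tooth is
    [b]. *)
Lemma strict_upper_up D : D \in strict_upper T A B C0 ->
  exists b, [/\ b \in B, b \in C0.1 & up b D].
Proof.
rewrite inE => /and3P[_ CD DC].
suff [DC'|//] : D = C0 \/ exists b, [/\ b \in B, b \in C0.1 & up b D] by rewrite DC' eqxx in DC.
apply: (connect_ind (P := fun K : subgraph G => K = C0 \/ exists b, [/\ b \in B, b \in C0.1 & up b K]) CD).
  by left.
move=> K K' HK KK'; have [->|K'C] := eqVneq K' C0; first by left.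
right; have [KC|KC] := eqVneq K C0.
  move: KK'; rewrite KC => /and3P[_ fK' /orP[/eqP K'E|]].
    by rewrite K'E eqxx in K'C.
  move=> /edges_betweenP[e [a [b [aK' bC eab]]]]; move: aK' bC; rewrite !inE.
  by move=> /andP[aK' aA] /andP[bC bB]; exists b; split=> //; apply: up_first aA eab.
case: HK => [KE|[b [bB bC bK]]]; first by rewrite KE eqxx in KC.
by exists b; split=> //; apply: up_step bK _; rewrite /upr KK' KC K'C.
Qed.

(** A spine vertex [y] of [C0] has all its neighbours in the zero component of [x], by parity, which
    contradicts [zerocomp_up]. If [y] is a tooth, its edge to [D] is a first step up. *)
Lemma up_neighbours x y D : x \in B -> x \in C0.1 -> D \in factor_components T -> D != C0 ->
  up x D -> y \in neighbours D.1 -> y \in C0.1 ->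
  y \in B /\ up y D.
Proof.
move=> xB xC fD DC xD; rewrite inE => /andP[_ /exists_inP[c cD /existsP[e ecy]]] yC.
have yB : y \in B.
  apply: contraT => yB; case/negP: (zerocomp_up xB xC xD).
  have y0 : y \in zerocomp T F0 x.
    exact: (zerocomp_factor bip F0min (zerocomp_refl T F0 x) (fcomp_conn fC0 xC yC)).
  apply: (zerocomp_sub fD cD); apply: (zerocomp_down bip F0min _ y0).
    by rewrite xB.
  by rewrite joins_sym; exact: ecy.
split=> //; apply: (up_first fD DC cD _ ecy).
by rewrite color_compl; have := bip_joins bip ecy; rewrite yB addbT.
Qed.

(** * Equivalence classes of teeth in [C0] *)

Lemma sim_C0 x y : x \in C0.1 -> sim T x y <-> (y \in C0.1) && (y \notin lev (rooted x) n).
Proof.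
move=> xC; split=> [sxy|/andP[yC yn]]; last by apply/(simP bip F0min fC0 xC yC).
have [[H fH /andP[xH yH]] _] := sxy.
have HC : H = C0 by apply: (fcomp_eq grT fH fC0 xH xC); apply: connect0.
by rewrite HC in yH; rewrite yH; apply/(simP bip F0min fC0 xC yH).
Qed.

Lemma tooth_spec S : tooth_class T B C0.1 S -> exists x, [/\ x \in S, x \in C0.1
  & forall y, (y \in S) = (y \in C0.1) && (y \notin lev (rooted x) n)].
Proof.
move=> [[x Sx] sS]; have fx := class_graft_fcomp grT x.
have xx : x \in (class_graft T x).1 := factor_class_refl T x.
have xS : x \in S by apply/Sx/(simP bip F0min fx xx xx); apply: root_notin_lev.
have xC : x \in C0.1 by have := subsetP sS _ xS; rewrite inE => /andP[].
exists x; split=> // y; apply/idP/idP => [/Sx|].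
  by move/(sim_C0 _ xC).
by move/(sim_C0 _ xC)/Sx.
Qed.

Lemma tooth_mem S b : tooth_class T B C0.1 S -> b \in S -> (b \in B) /\ (b \in C0.1).
Proof. by move=> [_ sS] bS; have := subsetP sS _ bS; rewrite inE => /andP[]. Qed.

(** By transitivity of zero distance in [C0], any member of the class can replace the representative
    defining it. *)
Lemma tooth_class_mem S b y : tooth_class T B C0.1 S -> b \in S ->
  (y \in S) = (y \in C0.1) && (y \notin lev (rooted b) n).
Proof.
move=> hS bS; have [x [xS xC SE]] := tooth_spec hS; rewrite SE.
have := bS; rewrite SE => /andP[bC bx].
case: (boolP (y \in C0.1)) => //= yC; congr (~~ _).
have conn u v : u \in C0.1 -> v \in C0.1 -> factor_connected T u v := fcomp_conn fC0.
apply/idP/idP; apply: contraTT => yn.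
  by apply: (level_zero_trans bip F0min (conn b x _ _) (conn b y _ _)) => //; rewrite lev_sym.
by apply: (level_zero_trans bip F0min (conn x b _ _) (conn x y _ _)).
Qed.

Lemma tooth_class_eq S S' b b' : tooth_class T B C0.1 S -> tooth_class T B C0.1 S' ->
  b \in S -> b' \in S' -> b' \notin lev (rooted b) n -> S = S'.
Proof.
move=> hS hS' bS bS' bb'; have [_ b'C] := tooth_mem hS' bS'.
have b'S : b' \in S by rewrite (tooth_class_mem b' hS bS) b'C.
by apply/setP => y; rewrite (tooth_class_mem y hS b'S) (tooth_class_mem y hS' bS').
Qed.

Lemma tooth_class_ex b : b \in B -> b \in C0.1 -> exists2 S, tooth_class T B C0.1 S & b \in S.
Proof.
move=> bB bC; exists [set y in C0.1 | y \notin lev (rooted b) n]; last first.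
  by rewrite inE bC root_notin_lev.
split; first by exists b => y; rewrite inE; split => /(sim_C0 _ bC).
apply/subsetP => y; rewrite inE in_setI => /andP[yC yn]; rewrite yC /=.
(* A spine vertex of [C0] is at odd distance from [b], hence at negative distance and not at
   distance 0. *)
apply: contraNT yn => yB; apply: (lev_opposite bip F0min); first by rewrite bB.
apply: (zerocomp_lev F0min).
exact: (zerocomp_factor bip F0min (zerocomp_refl T F0 b) (fcomp_conn fC0 bC yC)).
Qed.

(** * The partition of the strict upper bounds and its uniqueness *)

Definition upper_class (S : {set V}) : {set subgraph G} := [set D | [exists b in S, up b D]].

Lemma upper_classP (S : {set V}) D : reflect (exists2 b, b \in S & up b D) (D \in upper_class S).
Proof. by rewrite inE; apply: exists_inP. Qed.

Lemma upper_class_sub S D : tooth_class T B C0.1 S -> D \in upper_class S ->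
  D \in strict_upper T A B C0.
Proof.
by move=> hS /upper_classP[b /(tooth_mem hS)[bB bC]]; apply: up_strict_upper.
Qed.

Lemma upper_class_ex D : D \in strict_upper T A B C0 ->
  exists2 S, tooth_class T B C0.1 S & D \in upper_class S.
Proof.
move=> /strict_upper_up[b [bB bC bD]]; have [S hS bS] := tooth_class_ex bB bC.
by exists S => //; apply/upper_classP; exists b.
Qed.

Lemma upper_class_inj S S' D : tooth_class T B C0.1 S -> tooth_class T B C0.1 S' ->
  D \in upper_class S -> D \in upper_class S' -> S = S'.
Proof.
move=> hS hS' /upper_classP[b bS bD] /upper_classP[b' bS' bD'].
have [bB bC] := tooth_mem hS bS; have [b'B b'C] := tooth_mem hS' bS'.
by apply: (tooth_class_eq hS hS' bS bS'); apply: up_same_class bD bD'.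
Qed.

Lemma strict_upperP D : D \in strict_upper T A B C0 -> D \in factor_components T /\ D != C0.
Proof. by rewrite inE => /and3P[]. Qed.

Lemma upper_class_upr S D D' : D \in upper_class S -> upr D D' -> D' \in upper_class S.
Proof.
move=> /upper_classP[b bS bD] DD'; apply/upper_classP; exists b => //.
exact: up_step bD DD'.
Qed.

Lemma edge_upr D D' : D \in strict_upper T A B C0 -> D' \in strict_upper T A B C0 ->
  edges_between D.1 D'.1 != set0 -> upr D D' \/ upr D' D.
Proof.
move=> /strict_upperP[fD DC] /strict_upperP[fD' DC'] /edges_betweenP[e [a [b [aD bD' eab]]]].
rewrite /upr /below1 fD fD' DC DC' /= !andbT.
have := bip_joins bip eab; case: (boolP (a \in B)) => aB /= bB; [left|right]; apply/orP; right.
  apply/edges_betweenP; exists e, b, a; rewrite joins_sym !inE aD bD' aB color_compl.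
  by split.
by apply/edges_betweenP; exists e, a, b; rewrite !inE aD bD' color_compl aB bB.
Qed.

Lemma upper_class_partition : upper_partition T A B C0 upper_class.
Proof.
split.
- split=> [S hS|D /upper_class_ex //|S S' hS hS' neq].
    by apply/subsetP => D; apply: upper_class_sub.
  rewrite -setI_eq0; apply/set0Pn => -[D]; rewrite in_setI => /andP[DS DS'].
  exact: neq (upper_class_inj hS hS' DS DS').
- move=> D S uD hS /set0Pn[y yD] /subsetP sS; have [fD DC] := strict_upperP uD.
  have yS := sS _ yD; have [yB yC] := tooth_mem hS yS.
  move: yD; rewrite in_setI => /andP[+ _]; rewrite inE => /andP[_ /exists_inP[a aD /existsP[e eay]]].
  apply/upper_classP; exists y => //; apply: (up_first fD DC aD _ eay).
  by rewrite color_compl; have := bip_joins bip eay; rewrite yB addbT.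
move=> D D' S uD hS D'S DD'; have uD' := upper_class_sub hS D'S.
case: (edge_upr uD uD' DD') => H; last exact: upper_class_upr D'S H.
(* When [D] is the lower of the two, going up from its own member [S'] reaches [D'], which forces
   [S' = S]. *)
have [S' hS' DS'] := upper_class_ex uD.
by rewrite (upper_class_inj hS hS' D'S (upper_class_upr DS' H)).
Qed.

(** Condition (i) places the first member of the chain, all of whose neighbours in [C0] lie in [S]
    by [up_same_class]. Condition (ii) then places each later member through the edge of the
    step. *)
Lemma upper_partition_ge U S D : upper_partition T A B C0 U -> tooth_class T B C0.1 S ->
  D \in upper_class S -> D \in U S.
Proof.
move=> [_ Ui Uii] hS /upper_classP[b bS /existsP[H /and4P[fH HC bH HD]]].
have [bB bC] := tooth_mem hS bS.
have upH : up b H by apply/existsP; exists H; rewrite fH HC bH connect0.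
have uH := up_strict_upper bB bC upH.
have [e [a [b' [aH b'b eab]]]] := edges_betweenP _ _ bH.
have bb : b' = b by apply/set1P.
rewrite bb {b' b'b bb} in eab; move: aH; rewrite in_setI => /andP[aH aA].
have HS : H \in U S.
  apply: (Ui _ _ uH hS).
    apply/set0Pn; exists b; rewrite in_setI bC andbT inE; apply/andP; split.
      apply/negP => bH'; have := outside_class bC fH HC bH'.
      by rewrite /factor_connected connect0.
    by apply/exists_inP; exists a => //; apply/existsP; exists e.
  apply/subsetP => y; rewrite in_setI => /andP[yH yC].
  have [yB yup] := up_neighbours bB bC fH HC upH yH yC.
  by rewrite (tooth_class_mem y hS bS) yC; apply: up_same_class upH yup.
suff /andP[] : up b D && (D \in U S) by [].
apply: (connect_ind (P := fun K : subgraph G => is_true (up b K && (K \in U S))) HD).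
  by rewrite upH.
move=> K K' /andP[bK KS] KK'; have bK' := up_step bK KK'; rewrite bK' /=.
case: (upr_edge KK') => [<- //|[f [c [d [cK' dK _ _ fcd]]]]].
apply: (Uii _ K) => //; first exact: up_strict_upper bK'.
by apply/edges_betweenP; exists f, c, d.
Qed.

(** Both families partition the same set, so memberwise inclusion gives equality. *)
Lemma upper_partition_uniq U S : upper_partition T A B C0 U -> tooth_class T B C0.1 S ->
  U S = upper_class S.
Proof.
move=> hU hS; have [[Usub _ Udisj] _ _] := hU.
apply/setP => D; apply/idP/idP => [DS|]; last exact: upper_partition_ge.
have [S' hS' DS'] := upper_class_ex (subsetP (Usub _ hS) _ DS).
have DU := upper_partition_ge hU hS' DS'.
have [<- //|/eqP SS'] := eqVneq S' S.
by have := disjointFr (Udisj _ _ hS' hS SS') DU; rewrite DS.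
Qed.

End Upper.

Theorem theorem8p3 (G : mgraph) (T A B : {set vertex G}) (C0 : subgraph G)
    (hcomb : comb_bipartite T A B) (hC0 : C0 \in factor_components T) :
  exists U : {set vertex G} -> {set subgraph G},
    upper_partition T A B C0 U /\
    (forall U' : {set vertex G} -> {set subgraph G},
       upper_partition T A B C0 U' ->
       forall S : {set vertex G}, tooth_class T B C0.1 S -> U' S = U S).
Proof.
have /and3P[grT colAB _] := hcomb; have [F0 F0min] := graft_min_join grT.
exists (upper_class T A B C0); split.
  exact: upper_class_partition colAB grT F0min hC0.
by move=> U' hU' S hS; rewrite (upper_partition_uniq colAB grT F0min hC0 hU' hS).
Qed.
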